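(* Let $K$ be a field and let $d\geq 2$ be an integer. Then the subgroup $\mathrm{LGL}_d(K)$ of $L_K(R_d)^\times$ generated by all elements $u(A,M,B)$ (where $A,B$ are ordered $d$-ary leaf sets of the same cardinality $n$ and $M\in \mathrm{GL}_n(K)$, with $n\ge 1$ arbitrary) is the full unit group: $$\mathrm{LGL}_d(K)=L_K(R_d)^\times .$$
   Context: $L_d=L_K(R_d)$ (the Leavitt algebra $L_K(1,d)$) is the unital associative $K$-algebra generated by $a_1,\ldots,a_d,a_1^*,\ldots,a_d^*$ subject to $a_i^*a_j=\delta_{ij}1$ and $\sum_{i=1}^d a_ia_i^*=1$. A word $\alpha=a_{i_1}\cdots a_{i_r}$ in the free monoid $\{a_1,\ldots,a_d\}^*$ (with empty word $1$) is viewed as an element of $L_d$, and $\alpha^*=a_{i_r}^*\cdots a_{i_1}^*$, $1^*=1$. The rooted $d$-ary tree has vertex set $\{a_1,\ldots,a_d\}^*$, root $1$, and $\gamma$ has children $\gamma a_1,\ldots,\gamma a_d$. A finite rooted subtree is full if it contains the root, is closed under prefixes, and each of its vertices has either all $d$ children or no child in it. A $d$-ary leaf set is the set of leaves of such a finite full subtree; equivalently, it is obtained from $\{1\}$ by finitely many simple expansions, each replacing an element $\gamma$ by $\gamma a_1,\ldots,\gamma a_d$. An ordered $d$-ary leaf set is an ordering $(\gamma_1,\ldots,\gamma_n)$ of a $d$-ary leaf set. For ordered $d$-ary leaf sets $A=(\alpha_1,\ldots,\alpha_n)$, $B=(\beta_1,\ldots,\beta_n)$ and $M=(m_{ij})\in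 \mathrm{GL}_n(K)$, put $u(A,M,B)=\sum_{i,j=1}^n m_{ij}\alpha_i\beta_j^*$; this is a unit of $L_d$ with inverse $u(B,M^{-1},A)$. For a ring $R$, $R^\times$ denotes its unit group. *)

(* Defs.v *)
From HB Require Import structures.
From mathcomp Require Import all_boot all_order all_algebra.
From mathcomp Require Import finmap boolp monalg.

Set Implicit Arguments.
Unset Strict Implicit.
Unset Printing Implicit Defensive.

Import GRing.Theory.

Local Open Scope quotient_scope.
Local Open Scope ring_scope.

Inductive ideal_generated (R : nzRingType) (S : R -> Prop) : R -> Prop :=
| ideal_gen x of S x : ideal_generated S x
| ideal_zero : ideal_generated S 0
| ideal_sub x y of ideal_generated S x & ideal_generated S y :
    ideal_generated S (x - y)
| ideal_mull x y of ideal_generated S y : ideal_generated S (x * y)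
| ideal_mulr x y of ideal_generated S x : ideal_generated S (x * y).

(* Meant for sets S of units only: outside units, x^-1 is junk. *)
Inductive subgroup_generated (R : unitRingType) (S : R -> Prop) : R -> Prop :=
| subgroup_gen x of S x : subgroup_generated S x
| subgroup_one : subgroup_generated S 1
| subgroup_mul x y of subgroup_generated S x & subgroup_generated S y :
    subgroup_generated S (x * y)
| subgroup_inv x of subgroup_generated S x : subgroup_generated S x^-1.

(* The letter inl i stands for a_i and inr i for a_i^*; {fmonom _} is the     *)
(* free monoid, so free_algebra K d is the free unital associative K-algebra  *)
(* on these 2d letters.                                                       *)
Notation letter d := ('I_d + 'I_d)%type.
Notation free_algebra K d := {malg K[{fmonom letter d}]}.

Section Presentation.
Variables (K : fieldType) (d : nat).

Definition free_a (i : 'I_d) : free_algebra K d := << fmu (inl i) >>.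
Definition free_astar (i : 'I_d) : free_algebra K d := << fmu (inr i) >>.

Inductive leavitt_relator : free_algebra K d -> Prop :=
| leavitt_ortho i j :
    leavitt_relator (free_astar i * free_a j - (i == j)%:R)
| leavitt_sum : leavitt_relator (\sum_i free_a i * free_astar i - 1).

Definition leavitt_ideal : {pred free_algebra K d} :=
  fun x => `[< ideal_generated leavitt_relator x >].

Lemma leavitt_idealP x :
  reflect (ideal_generated leavitt_relator x) (x \in leavitt_ideal).
Proof. exact: asboolP. Qed.

Fact leavitt_ideal_zmod : zmod_closed leavitt_ideal.
Proof.
split=> [|x y /leavitt_idealP Ix /leavitt_idealP Iy].
  by apply/leavitt_idealP; constructor.
by apply/leavitt_idealP; constructor.
Qed.
HB.instance Definition _ :=
  GRing.isZmodClosed.Build (free_algebra K d) leavitt_ideal leavitt_ideal_zmod.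

Lemma leavitt_idealMl x y : y \in leavitt_ideal -> x * y \in leavitt_ideal.
Proof. by move=> /leavitt_idealP Iy; apply/leavitt_idealP; constructor. Qed.

Lemma leavitt_idealMr x y : x \in leavitt_ideal -> x * y \in leavitt_ideal.
Proof.
by move=> /leavitt_idealP Ix; apply/leavitt_idealP; apply: ideal_mulr.
Qed.

(* The ideal is proper: the free algebra acts on the sequences nat -> K, with *)
(* a_i spreading a sequence over the indices congruent to i modulo d and      *)
(* a_i^* extracting the subsequence at these indices.                         *)
Definition letter_act (l : letter d) (v : nat -> K) : nat -> K :=
  match l with
  | inl i => fun m => if (m %% d == i)%N then v (m %/ d)%N else 0
  | inr i => fun m => v (m * d + i)%N
  end.

Definition word_act (w : seq (letter d)) (v : nat -> K) : nat -> K :=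
  foldr letter_act v w.

Definition free_act (g : free_algebra K d) (v : nat -> K) (m : nat) : K :=
  mmap idfun (fun w : {fmonom letter d} => word_act w v m) g.

Lemma word_act_sum (T : Type) (r : seq T) (c : T -> K) (f : T -> nat -> K) w m :
  word_act w (fun m => \sum_(t <- r) c t * f t m) m =
  \sum_(t <- r) c t * word_act w (f t) m.
Proof.
elim: w m => //= l w IHw m; case: l => i /=; last exact: IHw.
by case: ifP => _; [exact: IHw | rewrite big1 // => t _; rewrite mulr0].
Qed.

Lemma free_actU w v m : free_act << w >> v m = word_act w v m.
Proof. by rewrite /free_act mmapU mul1r. Qed.

Lemma free_actM x y v m : free_act (x * y) v m = free_act x (free_act y v) m.
Proof.
rewrite /free_act malgME raddf_sum [RHS]mmapE; apply: eq_bigr => i _ /=.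
rewrite raddf_sum word_act_sum mulr_sumr; apply: eq_bigr => j _ /=.
by rewrite mmapU fmM /word_act foldr_cat mulrA.
Qed.

Lemma free_act1 v m : free_act 1 v m = v m.
Proof. by rewrite -mpolyC1E free_actU fm1. Qed.

Lemma free_act0 v m : free_act 0 v m = 0.
Proof. exact: mmap0. Qed.

Lemma free_actB x y v m : free_act (x - y) v m = free_act x v m - free_act y v m.
Proof. exact: mmapB. Qed.

Lemma free_act_eq0 x m : free_act x (fun=> 0) m = 0.
Proof.
suff act0 w n : word_act w (fun=> 0) n = 0.
  by rewrite /free_act mmapE big1 // => w _; rewrite act0 mulr0.
by elim: w n => //= -[i|i] w IHw n /=; rewrite ?IHw ?if_same.
Qed.

Lemma free_act_ideal x v m : (0 < d)%N -> x \in leavitt_ideal ->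
  free_act x v m = 0.
Proof.
move=> d_gt0 /leavitt_idealP Ix; elim: Ix v m => {x}.
- move=> _ [i j|] v m; rewrite free_actB.
    rewrite free_actM free_actU fmU /= free_actU fmU /=.
    rewrite modnMDl divnMDl // divn_small // addn0 modn_small // -val_eqE eq_sym /=.
    by case: eqP; rewrite (free_act1, free_act0) subrr.
  rewrite free_act1 /free_act raddf_sum /=.
  under eq_bigr => i _ do
    rewrite -[mmap _ _ _]/(free_act _ v m) free_actM free_actU fmU /=.
  rewrite (bigD1 (Ordinal (ltn_pmod m d_gt0))) //= free_actU fmU /= eqxx.
  rewrite -divn_eq big1 ?addr0 ?subrr // => i ne_i.
  rewrite free_actU fmU /=; case: eqP => // mi.
  by rewrite -val_eqE /= mi eqxx in ne_i.
- by move=> v m; rewrite free_act0.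
- by move=> x y _ IHx _ IHy v m; rewrite free_actB IHx IHy subrr.
- move=> x y _ IHy v m; rewrite free_actM.
  by rewrite (_ : free_act y v = fun=> 0) ?free_act_eq0 //; exact/funext.
- by move=> x y _ IHx v m; rewrite free_actM.
Qed.

Lemma leavitt_ideal_proper : (0 < d)%N -> 1 \notin leavitt_ideal.
Proof.
move=> d_gt0; apply/negP => /(free_act_ideal (fun=> 1) 0 d_gt0)/eqP.
by rewrite free_act1 oner_eq0.
Qed.

End Presentation.

(* d_ge2 is an argument of the type because the algType interface requires    *)
(* 1 != 0, which fails for d = 0.                                             *)
Definition leavitt (K : fieldType) (d : nat) (d_ge2 : (2 <= d)%N) : Type :=
  Quotient.quot (@leavitt_ideal K d).

Section LeavittAlgebra.
Variables (K : fieldType) (d : nat) (d_ge2 : (2 <= d)%N).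
Local Notation F := (free_algebra K d).
Local Notation L := (leavitt K d_ge2).

HB.instance Definition _ := GRing.Zmodule.on L.

Definition leavitt_pi (x : F) : L := \pi_(Quotient.quot (@leavitt_ideal K d)) x.

Lemma leavitt_pi_surj (z : L) : exists x, leavitt_pi x = z.
Proof. by exists (repr z); exact: reprK. Qed.

Lemma leavitt_piP (x y : F) :
  leavitt_pi x = leavitt_pi y <-> x - y \in @leavitt_ideal K d.
Proof. by rewrite Quotient.idealrBE; split=> [/eqP|/eqP]. Qed.

Lemma leavitt_piB : {morph leavitt_pi : x y / x - y}.
Proof. by move=> x y; rewrite /leavitt_pi raddfB. Qed.
HB.instance Definition _ :=
  GRing.isZmodMorphism.Build F L leavitt_pi leavitt_piB.

Definition leavitt_mul (y z : L) : L := leavitt_pi (repr y * repr z).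
Definition leavitt_scale (c : K) (z : L) : L := leavitt_pi (c *: repr z).

Lemma leavitt_reprK (z : L) : leavitt_pi (repr z) = z.
Proof. exact: reprK. Qed.

Lemma leavitt_piM x y :
  leavitt_pi (x * y) = leavitt_mul (leavitt_pi x) (leavitt_pi y).
Proof.
apply/leavitt_piP; set x' := repr _; set y' := repr _.
have -> : x * y - x' * y' = (x - x') * y + x' * (y - y').
  by rewrite mulrBl mulrBr addrA subrK.
apply: rpredD; [apply: leavitt_idealMr | apply: leavitt_idealMl];
  by apply/leavitt_piP; rewrite leavitt_reprK.
Qed.

Lemma leavitt_piZ c x : leavitt_pi (c *: x) = leavitt_scale c (leavitt_pi x).
Proof.
apply/leavitt_piP; rewrite -scalerBr -mul_malgC; apply: leavitt_idealMl.
by apply/leavitt_piP; rewrite leavitt_reprK.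
Qed.

Fact leavitt_mulA : associative leavitt_mul.
Proof.
move=> x y z; rewrite -[x]leavitt_reprK -[y]leavitt_reprK -[z]leavitt_reprK.
by rewrite -!leavitt_piM mulrA.
Qed.

Fact leavitt_mul1 : left_id (leavitt_pi 1) leavitt_mul.
Proof. by move=> x; rewrite -[x]leavitt_reprK -leavitt_piM mul1r. Qed.

Fact leavitt_mulr1 : right_id (leavitt_pi 1) leavitt_mul.
Proof. by move=> x; rewrite -[x]leavitt_reprK -leavitt_piM mulr1. Qed.

Fact leavitt_mulDl : left_distributive leavitt_mul +%R.
Proof.
move=> x y z; rewrite -[x]leavitt_reprK -[y]leavitt_reprK -[z]leavitt_reprK.
by rewrite -raddfD -!leavitt_piM mulrDl raddfD.
Qed.

Fact leavitt_mulDr : right_distributive leavitt_mul +%R.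
Proof.
move=> x y z; rewrite -[x]leavitt_reprK -[y]leavitt_reprK -[z]leavitt_reprK.
by rewrite -raddfD -!leavitt_piM mulrDr raddfD.
Qed.

Fact leavitt_1neq0 : leavitt_pi 1 != 0.
Proof.
rewrite -(raddf0 leavitt_pi); apply/eqP => /leavitt_piP.
by rewrite subr0; apply/negP/leavitt_ideal_proper/ltnW.
Qed.

HB.instance Definition _ := GRing.Zmodule_isNzRing.Build L
  leavitt_mulA leavitt_mul1 leavitt_mulr1 leavitt_mulDl leavitt_mulDr
  leavitt_1neq0.

HB.instance Definition _ := GRing.isMonoidMorphism.Build F L leavitt_pi
  (erefl, leavitt_piM).

Fact leavitt_scaleA a b x :
  leavitt_scale a (leavitt_scale b x) = leavitt_scale (a * b) x.
Proof. by rewrite -[x]leavitt_reprK -!leavitt_piZ scalerA. Qed.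

Fact leavitt_scale1 : left_id 1 leavitt_scale.
Proof. by move=> x; rewrite -[x]leavitt_reprK -leavitt_piZ scale1r. Qed.

Fact leavitt_scaleDr : right_distributive leavitt_scale +%R.
Proof.
move=> c x y; rewrite -[x]leavitt_reprK -[y]leavitt_reprK.
by rewrite -raddfD -!leavitt_piZ scalerDr raddfD.
Qed.

Fact leavitt_scaleDl x : {morph leavitt_scale^~ x : a b / a + b}.
Proof.
by move=> a b; rewrite -[x]leavitt_reprK -!leavitt_piZ scalerDl raddfD.
Qed.

HB.instance Definition _ := GRing.Zmodule_isLmodule.Build K L
  leavitt_scaleA leavitt_scale1 leavitt_scaleDr leavitt_scaleDl.

HB.instance Definition _ :=
  GRing.isScalable.Build K F L *:%R leavitt_pi leavitt_piZ.

Fact leavitt_scaleAl (c : K) (x y : L) : c *: (x * y) = (c *: x) * y.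
Proof.
rewrite -[x]leavitt_reprK -[y]leavitt_reprK.
by rewrite -rmorphM -!linearZ -rmorphM scalerAl.
Qed.

HB.instance Definition _ :=
  GRing.Lmodule_isLalgebra.Build K L leavitt_scaleAl.

Lemma free_scaleAr (c : K) (x y : F) : c *: (x * y) = x * (c *: y).
Proof.
have cxC : c%:MP * x = x * c%:MP.
  rewrite [LHS]malgM_def [RHS]malgM_def fgmulUg fgmulgU.
  by apply: eq_bigr => w _; rewrite mul1m mulm1 [c * _]mulrC.
by rewrite -(mul_malgC c (x * y)) -(mul_malgC c y) mulrA cxC -mulrA.
Qed.

Fact leavitt_scaleAr (c : K) (x y : L) : c *: (x * y) = x * (c *: y).
Proof.
rewrite -[x]leavitt_reprK -[y]leavitt_reprK.
by rewrite -rmorphM -!linearZ -rmorphM free_scaleAr.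
Qed.

HB.instance Definition _ :=
  GRing.Lalgebra_isAlgebra.Build K L leavitt_scaleAr.

Definition leavitt_unit : {pred L} :=
  fun x => `[< exists y, y * x = 1 /\ x * y = 1 >].

Definition leavitt_inv (x : L) : L :=
  if pselect (exists y, y * x = 1 /\ x * y = 1) is left ex
  then projT1 (cid ex) else x.

Fact leavitt_mulVx : {in leavitt_unit, left_inverse 1 leavitt_inv *%R}.
Proof.
move=> x /asboolP Ux; rewrite /leavitt_inv; case: pselect => // ex.
by case: (cid ex) => y [].
Qed.

Fact leavitt_mulxV : {in leavitt_unit, right_inverse 1 leavitt_inv *%R}.
Proof.
move=> x /asboolP Ux; rewrite /leavitt_inv; case: pselect => // ex.
by case: (cid ex) => y [].
Qed.

Fact leavitt_unitP x y : y * x = 1 /\ x * y = 1 -> leavitt_unit x.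
Proof. by move=> xy1; apply/asboolP; exists y. Qed.

Fact leavitt_inv_out : {in [predC leavitt_unit], leavitt_inv =1 id}.
Proof. by move=> x /asboolP nUx; rewrite /leavitt_inv; case: pselect. Qed.

HB.instance Definition _ := GRing.NzRing_hasMulInverse.Build L
  leavitt_mulVx leavitt_mulxV leavitt_unitP leavitt_inv_out.

Definition leavitt_a (i : 'I_d) : L := leavitt_pi (free_a K i).
Definition leavitt_astar (i : 'I_d) : L := leavitt_pi (free_astar K i).

(* The word a_{i_1} ... a_{i_r} is the sequence i_1, ..., i_r.                *)
Definition word_val (w : seq 'I_d) : L := \prod_(i <- w) leavitt_a i.
Definition word_star (w : seq 'I_d) : L := \prod_(i <- rev w) leavitt_astar i.

Definition u_elt (n : nat) (A : n.-tuple (seq 'I_d)) (M : 'M[K]_n)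
    (B : n.-tuple (seq 'I_d)) : L :=
  \sum_(i < n) \sum_(j < n)
    M i j *: (word_val (tnth A i) * word_star (tnth B j)).

End LeavittAlgebra.

Section LeafSets.
Variable d : nat.
Implicit Type T : {fset seq 'I_d}.

(* The vertices of the rooted d-ary tree are the words; the children of w are *)
(* the words rcons w i.                                                       *)
Definition full_subtree T : Prop :=
  [/\ [::] \in T,
      forall v w : seq 'I_d, prefix v w -> w \in T -> v \in T &
      forall w, w \in T ->
        (forall i, rcons w i \in T) \/ (forall i, rcons w i \notin T)].

Definition leaves T : {fset seq 'I_d} :=
  [fset w in T | [forall i : 'I_d, rcons w i \notin T]]%fset.

Definition ordered_leaf_set (s : seq (seq 'I_d)) : Prop :=
  uniq s /\ exists2 T, full_subtree T & s =i leaves T.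

End LeafSets.

Section LGL.
Variables (K : fieldType) (d : nat) (d_ge2 : (2 <= d)%N).

Inductive LGL_gen : leavitt K d_ge2 -> Prop :=
| LGL_gen_u (n : nat) (A B : n.-tuple (seq 'I_d)) (M : 'M[K]_n) of
    (1 <= n)%N & ordered_leaf_set A & ordered_leaf_set B & M \in unitmx :
    LGL_gen (u_elt d_ge2 A M B).

Definition LGL : leavitt K d_ge2 -> Prop := subgroup_generated LGL_gen.

End LGL.

(* Main.v *)
(* Let x be a unit of the Leavitt algebra L and A the free algebra on the a_i *)
(* inside L. Two leaf sets s1, s2 turn x into a matrix P = (v^* x w), v in    *)
(* s1, w in s2, and taking the words of s2 long makes P a matrix over A. The  *)
(* inverse of P becomes a matrix over A after right multiplication by all     *)
(* words of some length m. If m > 0, constant matrices (elements of LGL)      *)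
(* bring P(0) to the form pid_mx r; replacing the row leaves of index at      *)
(* least r by their children keeps P over A, since a_i^* only meets entries   *)
(* without constant term, and lowers m by one. When m = 0, P is invertible    *)
(* over A, and the weak algorithm of the free algebra reduces it to the       *)
(* identity by transvections and scalings. A transvection 1 + v z w^*, with   *)
(* v, w distinct leaves and z in L, is a product of elements 1 + c v' w'^*    *)
(* with v', w' incomparable words, and these are u(s, M, s) with M elementary *)
(* and s a leaf set containing v' and w'.                                     *)

Require Import Defs.
From mathcomp Require Import all_boot all_order all_algebra.
From mathcomp Require Import finmap boolp monalg ring zify.

Set Implicit Arguments.
Unset Strict Implicit.
Unset Printing Implicit Defensive.

Import GRing.Theory.
Local Open Scope ring_scope.

(** A leaf set acts as a basis of L: the elements [V w * S w] are orthogonal idempotents of sum 1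
    ([leaf_ortho], [leaf_sum1]). An element is thus recovered from the matrix of its entries
    [S v * x * V w] in any two leaf sets, possibly of different sizes, and the generators [u(A,M,B)]
    are the elements with an invertible constant matrix; in particular they are units ([umx_unit]).

    For the converse, the freedom to expand leaves is used twice. It splits a transvection with an
    arbitrary entry of L into constant ones ([G_leaf_transvection]), so every elementary operation
    lies in the group. It also makes the matrix of a given unit polynomial in the [a_i], since a
    long word absorbs all stars on its left ([eventually_Pol]). The inverse matrix may still contain
    stars; [G_denominator] removes them by induction on the length of words needed to absorb them.

    Once both matrices are polynomial, the free algebra replaces a Euclidean domain: if the entries
    of a column satisfy a relation [y * x = 1], one of them can be lowered in degree by multiples of
    the others ([column_lower]), so the column reduces to a single leaf ([column_reduce]). Treating
    all columns in turn ([G_polynomial_matched]) leaves a bijection between two leaf sets, which is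
    a generator with M = 1.

    Polynomials are handled inside L. Their coefficients are read off from the action on sequences,
    which makes the words in the [a_i] linearly independent ([pol_ev_eq0]). *)

Lemma degree_drop e si ti sj tj : (2 <= ti)%N -> e.+1 = si ->
  (sj + tj <= si + ti)%N -> (sj + tj = si + ti -> tj <= ti)%N ->
  ((minn e sj + tj).-1 <= e + ti.-1)%N.
Proof. lia. Qed.

Lemma seq_argmax (T : eqType) (r : seq T) (P : pred T) (f : T -> nat) :
  has P r -> exists2 x, (x \in r) && P x &
    forall y, y \in r -> P y -> (f y <= f x)%N.
Proof.
elim: r => //= y r IHr; have [/IHr[x /andP[xr Px] max_x] _|nPr] := boolP (has P r).
  have [Py|nPy] := boolP (P y); last first.
    exists x; rewrite ?inE ?xr ?orbT // => z; rewrite inE => /orP[/eqP->|]; last exact: max_x.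
    by rewrite (negPf nPy).
  have [yx|xy] := leqP (f y) (f x).
    exists x; rewrite ?inE ?xr ?orbT // => z; rewrite inE => /orP[/eqP->//|]; exact: max_x.
  exists y; rewrite ?mem_head // => z; rewrite inE => /orP[/eqP->//|zr Pz].
  exact: leq_trans (max_x z zr Pz) (ltnW xy).
rewrite orbF => Py; exists y; rewrite ?mem_head // => z; rewrite inE.
by move=> /orP[/eqP->//|zr Pz]; have /hasPn/(_ z zr) := nPr; rewrite Pz.
Qed.

(** * Combinatorics of leaf sets: prefixes and expansions *)

Section LeafSetTheory.
Variables (d : nat).
Hypothesis d_gt0 : (0 < d)%N.
Local Notation word := (seq 'I_d).
Implicit Types (u v w : word) (s t : seq word).

Lemma prefix_of_rcons u w i : prefix u (rcons w i) = (u == rcons w i) || prefix u w.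
Proof.
apply/prefixP/orP => [[t]|[/eqP->|/prefixP[t ->]]]; last 2 first.
- by exists [::]; rewrite cats0.
- by exists (rcons t i); rewrite rcons_cat.
case/lastP: t => [|t j]; first by rewrite cats0 => ->; left.
by rewrite -rcons_cat => /rcons_inj[-> _]; right; apply: prefix_prefix.
Qed.

Definition children w : seq word := [seq rcons w i | i <- enum 'I_d].

Lemma mem_children w v : (v \in children w) = [exists i, v == rcons w i].
Proof.
apply/mapP/existsP => [[i _ ->]|[i /eqP->]]; first by exists i.
by exists i; rewrite ?mem_enum.
Qed.

Lemma ordered_leaf_set_perm s t :
  perm_eq s t -> ordered_leaf_set s -> ordered_leaf_set t.
Proof.
move=> st [us [T fT sT]]; split; first by rewrite -(perm_uniq st).
by exists T => // w; rewrite -(perm_mem st).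
Qed.

Lemma ordered_leaf_set_nil : ordered_leaf_set [:: [::] : word].
Proof.
split=> //; exists [fset [::]]%fset.
  split=> [|v w|w]; rewrite ?inE //.
    by move=> /prefixP[t ->] /eqP; case: v.
  by move=> /eqP->; right=> i; rewrite inE.
move=> w; rewrite !inE /=; case: eqP => //= ->; apply/esym/forallP => i.
by rewrite inE.
Qed.

Lemma leaves_incomparable s v w :
  ordered_leaf_set s -> v \in s -> w \in s -> v != w -> ~~ prefix v w.
Proof.
move=> [_ [T [_ pT _] sT]]; rewrite !sT !inE /= => /andP[_ /forallP nT].
move=> /andP[wT _]; apply: contra_neqN => /prefixP[[|i t] wE].
  by rewrite wE cats0.
have := nT i; rewrite (pT _ w) //.
by rewrite wE -cat_rcons prefix_prefix.
Qed.

(** The shortest prefix of [u] outside the finite subtree has its parent inside; that parent misses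
    one child, hence all of them, so it is a leaf. *)
Lemma leaf_prefix_long s : ordered_leaf_set s ->
  exists N, forall n (u : word), (N <= n)%N -> size u = n ->
   exists2 w, w \in s & prefix w u.
Proof.
move=> [us [T [T0 pT dT] sT]].
exists (\max_(w <- T) (size w).+1)%N => n u Nn su.
have uT : u \notin T.
  apply: contraTN Nn => uT; rewrite -ltnNge -su.
  by rewrite big_seq; apply: leq_bigmax_seq.
have : exists k, take k u \notin T by exists (size u); rewrite take_size.
case/ex_minnP => -[|k]; first by rewrite take0 T0.
move=> kT /(_ k)/contraNN; rewrite -ltnNge ltnSn => /(_ isT); rewrite negbK => ktT.
have ku : (k < size u)%N.
  rewrite ltnNge; apply: contra kT => uk.
  by rewrite take_oversize ?(leq_trans uk) // -(take_oversize uk).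
exists (take k u); last by rewrite -{2}(cat_take_drop k u) prefix_prefix.
rewrite sT !inE /= ktT /=; apply/forallP => i.
have [all_T|] := dT _ ktT; last exact.
have := all_T (tnth (in_tuple u) (Ordinal ku)).
by rewrite (tnth_nth i) /= -take_nth // (negPf kT).
Qed.

Lemma ordered_leaf_set_expand s w t :
  ordered_leaf_set (s ++ w :: t) -> ordered_leaf_set (s ++ children w ++ t).
Proof.
move=> st_leaf; have [us [T [T0 pT dT] sT]] := st_leaf.
have : w \in s ++ w :: t by rewrite mem_cat inE eqxx orbT.
rewrite sT !inE /= => /andP[wT /forallP wnT].
have st_w v : v \in s ++ w :: t -> v != w -> v \in T /\ v \notin children w.
  rewrite sT !inE /= => /andP[vT _] vw; split=> //; apply/negP.
  by rewrite mem_children => /existsP[i /eqP vE]; have := wnT i; rewrite -vE vT.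
have w_nst : w \notin s ++ t.
  by move: us; rewrite -cat1s uniq_catCA cons_uniq => /andP[].
have sub_st v : v \in s ++ t -> v \in T /\ v \notin children w.
  move=> vst; apply: st_w; last by apply: contraNneq w_nst => <-.
  by move: vst; rewrite !mem_cat inE => /orP[->//|->]; rewrite !orbT.
split.
  rewrite uniq_catCA cat_uniq map_inj_uniq ?enum_uniq; last first.
    by move=> i j /rcons_inj[].
  rewrite /=; move: us; rewrite -cat1s uniq_catCA cons_uniq => /andP[_ ->].
  by rewrite andbT; apply/hasPn => v /sub_st[].
exists (T `|` [fset v | v in children w])%fset.
  split=> [|u v|v]; rewrite !inE ?T0 //.
  - move=> uv /orP[vT|]; first by rewrite (pT u v).
    rewrite mem_children => /existsP[i /eqP vE]; move: uv; rewrite vE prefix_of_rcons.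
    case/orP=> [/eqP->|uw]; last by rewrite (pT u w).
    by rewrite mem_children; apply/orP; right; apply/existsP; exists i.
  - have chw x i : (rcons x i \in children w) = (x == w).
      rewrite mem_children; apply/existsP/eqP => [[j /eqP/rcons_inj[]]//|->].
      by exists i.
    case: (v =P w) => [->|/eqP vw] vT.
      by left=> i; rewrite !inE chw eqxx orbT.
    case/orP: vT => [vT|vc].
      by have [h|h] := dT v vT; [left|right] => i; rewrite !inE chw (negPf vw) orbF.
    right=> i; rewrite !inE chw (negPf vw) orbF.
    move: vc; rewrite mem_children => /existsP[j /eqP vE].
    apply: contra (wnT j) => viT; rewrite -vE; apply: pT viT.
    exact: prefix_rcons.
move=> v; rewrite !inE /=.
have -> : (v \in s ++ children w ++ t) = (v \in children w) || (v \in s ++ t).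
  by rewrite !mem_cat orbCA.
have chw x i : (rcons x i \in children w) = (x == w).
  rewrite mem_children; apply/existsP/eqP => [[j /eqP/rcons_inj[]]//|->].
  by exists i.
have forE : [forall i, rcons v i \notin (T `|` [fset v | v in children w])%fset] =
            [forall i, rcons v i \notin T] && (v != w).
  case: (v =P w) => [->|/eqP vw]; rewrite ?andbF ?andbT.
    by apply/negbTE/forallPn; exists (Ordinal d_gt0); rewrite !inE chw eqxx orbT.
  by apply: eq_forallb => i; rewrite !inE chw (negPf vw) orbF.
rewrite forE; case: (boolP (v \in children w)) => vc /=; rewrite ?orbT ?orbF /=.
  move: vc; rewrite mem_children => /existsP[j /eqP ->].
  apply/esym/andP; split; last first.
    by apply/eqP => /(congr1 size)/eqP; rewrite size_rcons -addn1 -{2}[size w]addn0 eqn_add2l.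
  apply/forallP => i; apply: contra (wnT j) => viT; apply: pT viT.
  exact: prefix_rcons.
have -> : (v \in s ++ t) = (v \in s ++ w :: t) && (v != w).
  rewrite !mem_cat inE; case: (v =P w) => [->|_] /=; last by rewrite andbT.
  by rewrite andbF -mem_cat (negPf w_nst).
by rewrite sT !inE /= andbA.
Qed.

Lemma ordered_leaf_set_expand_all s t :
  ordered_leaf_set (s ++ t) -> ordered_leaf_set (s ++ flatten (map children t)).
Proof.
elim: t s => //= w t IHt s /ordered_leaf_set_expand; rewrite !catA.
exact: IHt.
Qed.

(** Applied at two different leaves in succession, this puts given extensions of both into a common
    leaf set. *)
Lemma ordered_leaf_set_extend s w v :
  ordered_leaf_set s -> w \in s -> exists s', [/\ ordered_leaf_set s',
    w ++ v \in s' & forall u, u \in s -> u != w -> u \in s'].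
Proof.
elim: v w s => [|i v IHv] w s s_leaf ws; first by exists s; rewrite cats0.
case/path.splitPr: ws s_leaf => s1 s2 /ordered_leaf_set_expand s_leaf.
have wi : rcons w i \in s1 ++ children w ++ s2.
  rewrite !mem_cat mem_children; apply/orP; right; apply/orP; left.
  by apply/existsP; exists i.
have [s' [s'_leaf wv sub]] := IHv _ _ s_leaf wi.
exists s'; split=> // [|u us uw]; first by rewrite -cat_rcons.
have us' : u \in s1 ++ s2.
  by move: us; rewrite !mem_cat inE (negPf uw).
have [uwi|] := eqVneq u (rcons w i); last first.
  by apply: sub; move: us'; rewrite !mem_cat => /orP[->//|->]; rewrite !orbT.
have [+ _] := s_leaf; rewrite uniq_catCA cat_uniq => /and3P[_ /hasPn/(_ u us')].
by rewrite /= uwi mem_children => /existsP[]; exists i.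
Qed.

Lemma ordered_leaf_set_long n : exists2 s : seq word,
  ordered_leaf_set s & forall w, w \in s -> size w = n.
Proof.
elim: n => [|n [s s_leaf sn]].
  exists [:: [::]]; first exact: ordered_leaf_set_nil.
  by move=> w; rewrite inE => /eqP->.
exists (flatten (map children s)); first exact: (@ordered_leaf_set_expand_all [::]).
move=> w /flattenP[_ /mapP[v vs ->]]; rewrite mem_children => /existsP[i /eqP->].
by rewrite size_rcons sn.
Qed.

Lemma ordered_leaf_set_gt0 s : ordered_leaf_set s -> (0 < size s)%N.
Proof.
move=> /leaf_prefix_long[N /(_ N (nseq N (Ordinal d_gt0)) (leqnn N))].
by rewrite size_nseq => /(_ erefl)[]; case: s.
Qed.

End LeafSetTheory.

(* L, a, a' and the predicate G stand for the Leavitt algebra, its generators *)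
(* and LGL, of which only the properties listed as hypotheses are used.       *)
Section LeavittFamily.
Variables (K : fieldType) (d : nat) (L : unitAlgType K) (a a' : 'I_d -> L).
Local Notation word := (seq 'I_d).

Definition wval (w : word) : L := \prod_(i <- w) a i.
Definition wstar (w : word) : L := \prod_(i <- rev w) a' i.
Definition umx (n : nat) (A : n.-tuple word) (M : 'M[K]_n) (B : n.-tuple word)
    : L :=
  \sum_(i < n) \sum_(j < n) M i j *: (wval (tnth A i) * wstar (tnth B j)).

Hypothesis d_ge2 : (2 <= d)%N.
Hypothesis astar_a : forall i j, a' i * a j = (i == j)%:R.
Hypothesis sum_a_astar : \sum_i a i * a' i = 1.
Hypothesis leavitt_gen : forall P : L -> Prop, P 0 -> P 1 ->
  (forall c x y, P x -> P y -> P (c *: x + y)) ->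
  (forall x i, P x -> P (x * a i)) -> (forall x i, P x -> P (x * a' i)) ->
  forall x, P x.
Local Notation V := wval.
Local Notation S := wstar.
Implicit Types (u v w : word) (x y z : L) (s : seq word).

Let d_gt0 : (0 < d)%N := ltnW d_ge2.

(** * Words, their stars, and the spanning set of products [V u * S v] *)

Lemma wval_nil : V [::] = 1. Proof. by rewrite /wval big_nil. Qed.
Lemma wstar_nil : S [::] = 1. Proof. by rewrite /wstar big_nil. Qed.

Lemma wval_cat u v : V (u ++ v) = V u * V v.
Proof. by rewrite /wval big_cat. Qed.
Lemma wstar_cat u v : S (u ++ v) = S v * S u.
Proof. by rewrite /wstar rev_cat big_cat. Qed.

Lemma wval1 i : V [:: i] = a i. Proof. by rewrite /wval big_seq1. Qed.
Lemma wstar1 i : S [:: i] = a' i. Proof. by rewrite /wstar big_seq1. Qed.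

Lemma wval_cons i u : V (i :: u) = a i * V u.
Proof. by rewrite -cat1s wval_cat wval1. Qed.
Lemma wstar_cons i u : S (i :: u) = S u * a' i.
Proof. by rewrite -cat1s wstar_cat wstar1. Qed.
Lemma wval_rcons i u : V (rcons u i) = V u * a i.
Proof. by rewrite -cats1 wval_cat wval1. Qed.
Lemma wstar_rcons i u : S (rcons u i) = a' i * S u.
Proof. by rewrite -cats1 wstar_cat wstar1. Qed.

Lemma wstarK w : S w * V w = 1.
Proof.
elim: w => [|i w IHw]; first by rewrite wval_nil wstar_nil mul1r.
by rewrite wval_cons wstar_cons -mulrA (mulrA (a' i)) astar_a eqxx mul1r.
Qed.

Lemma wstar_catK u v : S u * V (u ++ v) = V v.
Proof. by rewrite wval_cat mulrA wstarK mul1r. Qed.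

Lemma wstar_incomparable u v : ~~ prefix u v -> ~~ prefix v u -> S u * V v = 0.
Proof.
elim: u v => [|i u IHu] [|j v] //=.
rewrite wval_cons wstar_cons -mulrA (mulrA (a' i)) astar_a.
by case: (i =P j) => [->|_]; rewrite ?eqxx ?mul0r ?mulr0 // mul1r; apply: IHu.
Qed.

Lemma wval_wstar_mul u v w : V u * S v * V w = 0 \/
  exists u' v', V u * S v * V w = V u' * S v' /\
    ((size v <= size w)%N -> v' = [::]).
Proof.
have [/prefixP[t ->]|nvw] := boolP (prefix v w).
  right; exists (u ++ t), [::]; split=> //.
  by rewrite -mulrA wstar_catK wstar_nil mulr1 wval_cat.
have [/prefixP[t ->]|nwv] := boolP (prefix w v).
  right; exists u, t; rewrite wstar_cat -!mulrA wstarK mulr1; split=> //.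
  by rewrite size_cat -{2}[size w]addn0 leq_add2l leqn0 => /eqP/size0nil.
by left; rewrite -mulrA wstar_incomparable ?mulr0.
Qed.

(** The induction proves the statement for all [P] at once, so that the hypothesis on [x] can be
    used with [fun x => P (x * a i)] and the like. *)
Lemma leavitt_span (P : L -> Prop) : P 0 ->
  (forall x y, P x -> P y -> P (x + y)) ->
  (forall c u v, P (c *: (V u * S v))) -> forall x, P x.
Proof.
move=> + + + x; move: P; move: x; apply: leavitt_gen => //.
- move=> P P0 PD PZ; have := PZ 1 [::] [::].
  by rewrite wval_nil wstar_nil mulr1 scale1r.
- move=> c x y Px Py P P0 PD PZ; apply: (PD); last exact: Py.
  apply: (Px (fun x => P (c *: x))); first by rewrite scaler0.
    by move=> x1 x2 *; rewrite scalerDr; apply: PD.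
  by move=> *; rewrite scalerA.
- move=> x i Px P P0 PD PZ.
  apply: (Px (fun x => P (x * a i))); first by rewrite mul0r.
    by move=> x1 x2 *; rewrite mulrDl; apply: PD.
  move=> c u v; rewrite -scalerAl -wval1.
  by have [->|[u' [v' [-> _]]]] := wval_wstar_mul u v [:: i]; rewrite ?scaler0.
- move=> x i Px P P0 PD PZ.
  apply: (Px (fun x => P (x * a' i))); first by rewrite mul0r.
    by move=> x1 x2 *; rewrite mulrDl; apply: PD.
  by move=> c u v; rewrite -scalerAl -mulrA -wstar_cons.
Qed.

Lemma sum_words n : exists2 s, (forall w, w \in s -> size w = n) &
  \sum_(w <- s) V w * S w = 1.
Proof.
elim: n => [|n [s sn sum1]].
  exists [:: [::]] => [w|]; first by rewrite inE => /eqP->.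
  by rewrite big_seq1 wval_nil wstar_nil mulr1.
exists (flatten (map (@children d) s)).
  move=> w /flattenP[_ /mapP[v vs ->]]; rewrite mem_children => /existsP[i /eqP->].
  by rewrite size_rcons sn.
rewrite big_flatten big_map -[RHS]sum1; apply: eq_bigr => w _.
rewrite big_map big_enum /= -[in RHS](mulr1 (V w)) -sum_a_astar mulr_sumr mulr_suml.
by apply: eq_bigr => i _; rewrite wval_rcons wstar_rcons !mulrA.
Qed.

(** * The orthogonal idempotents of a leaf set *)

Section LeafSet.
Variables (s : seq word) (s_leaf : ordered_leaf_set s).

Lemma leaf_ortho v w : v \in s -> w \in s -> S v * V w = (v == w)%:R.
Proof.
move=> vs ws; case: eqP => [->|/eqP vw]; first exact: wstarK.
by rewrite wstar_incomparable ?(leaves_incomparable s_leaf) // eq_sym.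
Qed.

(* Each word of a large length n has exactly one prefix in s, so the          *)
(* idempotents of the leaves group those of the words of length n.            *)
Lemma leaf_sum1 : \sum_(w <- s) V w * S w = 1.
Proof.
have [us _] := s_leaf.
have [N sN] := leaf_prefix_long s_leaf.
pose n := maxn N (\max_(w <- s) size w).
have [t tn t1] := sum_words n.
have VS w u : w \in s -> u \in t ->
    V w * S w * (V u * S u) = if prefix w u then V u * S u else 0.
  move=> ws ut; case: ifP => [/prefixP[r ->]|/negbT wu].
    by rewrite wval_cat !mulrA -(mulrA (V w)) wstarK mulr1.
  rewrite -mulrA (mulrA (S w)) wstar_incomparable ?mul0r ?mulr0 //.
  apply: contra wu => /prefixP[r rE].
  have : (size w <= size u)%N.
    by rewrite (tn u ut) leq_max; apply/orP; right; apply: leq_bigmax_seq.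
  rewrite rE size_cat -{2}[size u]addn0 leq_add2l leqn0 => /eqP/size0nil->.
  by rewrite cats0 prefix_refl.
rewrite -[LHS]mulr1 -{1}t1 mulr_sumr -[RHS]t1 big_seq [RHS]big_seq.
apply: eq_bigr => u ut; rewrite mulr_suml.
have [w ws wu] := sN _ u (leq_maxl _ _) (tn u ut).
rewrite (big_rem w) //= VS // wu big_seq big1 ?addr0 // => v.
rewrite mem_rem_uniq // inE => /andP[vw vs]; rewrite VS //.
case: ifP => // vu; have [] := boolP (prefix v w).
  by rewrite (negPf (leaves_incomparable s_leaf _ _ _)).
have := leaves_incomparable s_leaf ws vs; rewrite eq_sym => /(_ vw).
move: vu wu => /prefixP[v1 ->] /prefixP[w1 e] /negP nwv /negP[].
have [lvw|lwv] := leqP (size v) (size w).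
  by rewrite prefixE -[w](take_size_cat w1 erefl) -e take_takel // take_size_cat.
case: nwv; rewrite prefixE -[v in take _ v](take_size_cat v1 erefl) e take_takel.
  by rewrite take_size_cat.
exact: ltnW.
Qed.

Lemma leaf_expandl x : x = \sum_(w <- s) V w * (S w * x).
Proof.
by rewrite -{1}[x]mul1r -leaf_sum1 mulr_suml; apply: eq_bigr => w _; rewrite mulrA.
Qed.

Lemma leaf_expandr x : x = \sum_(w <- s) (x * V w) * S w.
Proof.
by rewrite -{1}[x]mulr1 -leaf_sum1 mulr_sumr; apply: eq_bigr => w _; rewrite mulrA.
Qed.

Lemma leaf_extr x y : (forall w, w \in s -> x * V w = y * V w) -> x = y.
Proof.
move=> xy; rewrite (leaf_expandr x) (leaf_expandr y) big_seq [RHS]big_seq.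
by apply: eq_bigr => w ws; rewrite xy.
Qed.
End LeafSet.

(** * Matrix calculus of the elements [umx A M B] *)

Lemma tnth_leaf_ortho n (A : n.-tuple word) : ordered_leaf_set A ->
  forall i j, S (tnth A i) * V (tnth A j) = (i == j)%:R.
Proof.
move=> A_leaf i j; rewrite (leaf_ortho A_leaf) ?mem_tnth //.
have [uA _] := A_leaf; rewrite !(tnth_nth [::]) nth_uniq ?size_tuple //.
Qed.

Lemma umx_val n (A B : n.-tuple word) (M : 'M[K]_n) j : ordered_leaf_set B ->
  umx A M B * V (tnth B j) = \sum_i M i j *: V (tnth A i).
Proof.
move=> B_leaf; rewrite /umx mulr_suml; apply: eq_bigr => i _.
rewrite mulr_suml (bigD1 j) //= -scalerAl -mulrA tnth_leaf_ortho // eqxx mulr1.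
rewrite big1 ?addr0 // => k kj.
by rewrite -scalerAl -mulrA tnth_leaf_ortho // (negPf kj) mulr0 scaler0.
Qed.

Lemma star_umx n (A B : n.-tuple word) (M : 'M[K]_n) i : ordered_leaf_set A ->
  S (tnth A i) * umx A M B = \sum_j M i j *: S (tnth B j).
Proof.
move=> A_leaf; rewrite /umx mulr_sumr (bigD1 i) //= [X in _ + X]big1 ?addr0.
  rewrite mulr_sumr; apply: eq_bigr => j _.
  by rewrite -scalerAr mulrA tnth_leaf_ortho // eqxx mul1r.
move=> k ki; rewrite mulr_sumr big1 // => j _.
by rewrite -scalerAr mulrA tnth_leaf_ortho // eq_sym (negPf ki) mul0r scaler0.
Qed.

Lemma umxM n (A B C : n.-tuple word) (M N : 'M[K]_n) : ordered_leaf_set B ->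
  umx A M B * umx B N C = umx A (M *m N) C.
Proof.
move=> B_leaf; transitivity (\sum_j \sum_k \sum_i
    (M i j * N j k) *: (V (tnth A i) * S (tnth C k))).
  rewrite {2}/umx mulr_sumr; apply: eq_bigr => j _.
  rewrite mulr_sumr; apply: eq_bigr => k _.
  rewrite -scalerAr mulrA umx_val // mulr_suml scaler_sumr.
  by apply: eq_bigr => i _; rewrite -scalerAl scalerA mulrC.
rewrite exchange_big /umx [RHS]exchange_big; apply: eq_bigr => k _.
rewrite exchange_big; apply: eq_bigr => i _.
by rewrite mxE scaler_suml.
Qed.

Lemma umx1 n (A : n.-tuple word) : ordered_leaf_set A -> umx A 1%:M A = 1.
Proof.
move=> A_leaf; rewrite -(leaf_sum1 A_leaf) big_tuple; apply: eq_bigr => i _.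
rewrite (bigD1 i) //= mxE eqxx scale1r big1 ?addr0 // => j ji.
by rewrite mxE eq_sym (negPf ji) scale0r.
Qed.

Lemma umx_unit n (A B : n.-tuple word) (M : 'M[K]_n) :
  ordered_leaf_set A -> ordered_leaf_set B -> M \in unitmx ->
  umx A M B \is a GRing.unit /\ (umx A M B)^-1 = umx B (invmx M) A.
Proof.
move=> A_leaf B_leaf M_unit.
have MV : umx A M B * umx B (invmx M) A = 1 by rewrite umxM // mulmxV // umx1.
have VM : umx B (invmx M) A * umx A M B = 1 by rewrite umxM // mulVmx // umx1.
have U : umx A M B \is a GRing.unit by apply/unitrP; exists (umx B (invmx M) A).
by split=> //; rewrite -[LHS]mulr1 -MV mulKr.
Qed.

(** * Transvections and scalings belong to the group *)

Variable G : L -> Prop.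
Hypothesis G_umx : forall n (A B : n.-tuple word) (M : 'M[K]_n), (0 < n)%N ->
  ordered_leaf_set A -> ordered_leaf_set B -> M \in unitmx -> G (umx A M B).
Hypothesis G_one : G 1.
Hypothesis G_mul : forall x y, G x -> G y -> G (x * y).
Hypothesis G_inv : forall x, G x -> G x^-1.

Lemma umx_elementary n (A : n.-tuple word) (c : K) i j : ordered_leaf_set A ->
  umx A (1%:M + c *: delta_mx i j) A =
  1 + c *: (V (tnth A i) * S (tnth A j)).
Proof.
move=> A_leaf; rewrite -[in RHS](umx1 A_leaf).
have -> : c *: (V (tnth A i) * S (tnth A j)) = umx A (c *: delta_mx i j) A.
  rewrite /umx (bigD1 i) //= (bigD1 j) //= !mxE !eqxx mulr1.
  rewrite !big1 ?addr0 // => [k ki|k kj].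
    by apply: big1 => l _; rewrite !mxE (negPf ki) /= mulr0 scale0r.
  by rewrite !mxE (negPf kj) andbF mulr0 scale0r.
rewrite /umx -big_split; apply: eq_bigr => k _; rewrite -big_split.
by apply: eq_bigr => l _; rewrite /= !mxE scalerDl.
Qed.

Lemma elementary_unitmx n (c : K) (i j : 'I_n) :
  (i != j) || (1 + c != 0) -> 1%:M + c *: delta_mx i j \in unitmx.
Proof.
(* On the diagonal [delta_mx i i] is idempotent and the inverse has parameter [c1] with
   [c + c1 + c * c1 = 0]; off the diagonal the matrix unit squares to zero. *)
move=> ijc; pose c1 := if i == j then - c / (1 + c) else - c.
suff /mulmx1_unit[] : (1%:M + c *: delta_mx i j) *m (1%:M + c1 *: delta_mx i j)
  = 1%:M by [].
rewrite mulmxDl !mulmxDr !mul1mx mulmx1 -scalemxAl -scalemxAr mul_delta_mx_cond.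
rewrite -addrA -[RHS]addr0; congr (_ + _).
rewrite /c1 (eq_sym j); case: eqP ijc => [<-|_] /= c0; last first.
  by rewrite mulr0n !scaler0 addr0 scaleNr ?addNr ?subrr.
rewrite mulr1n scalerA -!scalerDl; apply/eqP; rewrite scaler_eq0; apply/orP; left.
by apply/eqP; field.
Qed.

Lemma G_elementary s v w (c : K) : ordered_leaf_set s -> v \in s -> w \in s ->
  (v != w) || (1 + c != 0) -> G (1 + c *: (V v * S w)).
Proof.
move=> s_leaf /(tnthP (in_tuple s))[i ->] /(tnthP (in_tuple s))[j ->] vwc.
rewrite -(@umx_elementary _ (in_tuple s)) //; apply: G_umx => //.
  exact: (ordered_leaf_set_gt0 d_gt0).
apply: elementary_unitmx; case/orP: vwc => [|->]; last by rewrite orbT.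
by move=> vw; apply/orP; left; apply: contraNneq vw => ->.
Qed.

Lemma G_scaling s v (c : K) : ordered_leaf_set s -> v \in s -> c != 0 ->
  G (1 + (c - 1) *: (V v * S v)).
Proof.
by move=> s_leaf vs c0; apply: (G_elementary s_leaf) => //; rewrite addrCA subrr addr0 c0 orbT.
Qed.

Lemma transvectionMl (R : pzRingType) (x y z : R) : y * x = 0 ->
  (1 + x * y) * (1 + x * z) = 1 + x * (y + z).
Proof.
move=> yx; rewrite mulrDl mul1r [x * y * _]mulrDr mulr1 -!mulrA (mulrA y) yx mul0r mulr0.
by rewrite addr0 mulrDr -addrA [x * z + _]addrC.
Qed.

Lemma transvectionMr (R : pzRingType) (x y z : R) : z * y = 0 ->
  (1 + x * z) * (1 + y * z) = 1 + (x + y) * z.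
Proof.
move=> zy; rewrite mulrDl mul1r [x * z * _]mulrDr mulr1 -!mulrA (mulrA z) zy mul0r mulr0.
by rewrite addr0 mulrDl -addrA [y * z + _]addrC.
Qed.

(** As [S w * V v = 0], a sum in the middle factor becomes a product of transvections. By
    [leavitt_span] one may take [x = c *: (V u * S u')], which gives the constant transvection
    between the words [v ++ u] and [w ++ u'], leaves of a common leaf set. *)
Lemma G_leaf_transvection s v w x : ordered_leaf_set s -> v \in s -> w \in s ->
  v != w -> G (1 + V v * x * S w).
Proof.
move=> s_leaf vs ws vw; have SV : S w * V v = 0.
  by rewrite (leaf_ortho s_leaf) // eq_sym (negPf vw).
move: x; apply: leavitt_span => [|x y Gx Gy|c u u'].
- by rewrite mulr0 mul0r addr0.
- rewrite mulrDr -transvectionMr; first exact: G_mul.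
  by rewrite mulrA SV mul0r.
rewrite -scalerAr -scalerAl mulrA -wval_cat -mulrA -wstar_cat.
have [s1 [s1_leaf vu s1_sub]] := ordered_leaf_set_extend d_gt0 u s_leaf vs.
have [|s2 [s2_leaf wu s2_sub]] := ordered_leaf_set_extend d_gt0 u' s1_leaf (_ : w \in s1).
  by apply: s1_sub => //; rewrite eq_sym.
have nz (r r' : word) : v ++ r != w ++ r'.
  apply: contraNneq (oner_neq0 L) => E; rewrite -(wstarK r') -(wstar_catK w).
  by rewrite -E wval_cat (mulrA (S w)) SV mul0r mulr0.
apply: (G_elementary s2_leaf) => //; last by rewrite nz.
by apply: s2_sub => //; rewrite -[w]cats0 nz.
Qed.

(** Expanding [x] over the leaves factors the element into leaf transvections
    [1 + V v * (x * V w) * S w]; the term [w = v] vanishes by hypothesis. *)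
Lemma G_row_transvection s v x : ordered_leaf_set s -> v \in s ->
  x * V v = 0 -> G (1 + V v * x).
Proof.
move=> s_leaf vs xv; rewrite (leaf_expandr s_leaf x).
have : {subset s <= s} by [].
elim: {1 3}s => [|w t IHt] ts; first by rewrite big_nil mulr0 addr0.
rewrite big_cons; have ws := ts w (mem_head _ _); have xw : x * V w * S w * V v = 0.
  have [->|wv] := eqVneq w v; first by rewrite xv !mul0r.
  by rewrite -mulrA (leaf_ortho s_leaf) // (negPf wv) mulr0.
rewrite -transvectionMl //; apply: G_mul; last first.
  by apply: IHt => u ut; rewrite ts // inE ut orbT.
have [->|wv] := eqVneq w v; first by rewrite xv mul0r mulr0 addr0.
by rewrite mulrA; apply: (G_leaf_transvection _ s_leaf); rewrite // eq_sym.
Qed.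

Lemma G_col_transvection s v x : ordered_leaf_set s -> v \in s ->
  S v * x = 0 -> G (1 + x * S v).
Proof.
move=> s_leaf vs vx; rewrite (leaf_expandl s_leaf x).
have : {subset s <= s} by [].
elim: {1 3}s => [|w t IHt] ts; first by rewrite big_nil mul0r addr0.
rewrite big_cons addrC; have ws := ts w (mem_head _ _); have wx : S v * (V w * (S w * x)) = 0.
  have [->|wv] := eqVneq w v; first by rewrite vx !mulr0.
  by rewrite mulrA (leaf_ortho s_leaf) // eq_sym (negPf wv) mul0r.
rewrite [X in X * _]addrC addrC -transvectionMr //; apply: G_mul.
  by apply: IHt => u ut; rewrite ts // inE ut orbT.
have [->|wv] := eqVneq w v; first by rewrite vx mulr0 mul0r addr0.
exact: (G_leaf_transvection _ s_leaf).
Qed.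

(** * Polynomials in the [a_i] inside L: coefficients, derivations, degree *)

Variable act : L -> (nat -> K) -> nat -> K.
Hypothesis act_lin : forall c x y (f : nat -> K) m,
  act (c *: x + y) f m = c * act x f m + act y f m.
Hypothesis act_one : forall f m, act 1 f m = f m.
Hypothesis actM : forall x y f m, act (x * y) f m = act x (act y f) m.
Hypothesis act_a : forall i f m,
  act (a i) f m = if (m %% d == i)%N then f (m %/ d)%N else 0.
Hypothesis act_astar : forall i f m, act (a' i) f m = f (m * d + i)%N.

(* The base-d digits of n, preceded by a leading 1, encode the word w with    *)
(* V w . delta_1 = delta_n; thus ev x reads the coefficients of a polynomial  *)
(* x in the a_i, the constant one at 1, while positive-length words in the    *)
(* a_i^* contribute at 0 only.                                                *)
Definition ev x (m : nat) : K := act x (fun n => (n == 1)%:R) m.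
Definition eps x : K := ev x 1.

(** On a polynomial this keeps the words beginning with [a i] and strips that letter; subtracting
    the constant term first prevents a stray [a' i]. *)
Definition der i x : L := a' i * (x - (eps x)%:A).

Fixpoint derw w x : L := if w is i :: w' then derw w' (der i x) else x.

(** Membership in the span of the words in the [a_i] of length less than [n]; the bound is thus the
    degree plus one. *)
Fixpoint pol n x : Prop :=
  if n is n'.+1 then forall i, pol n' (der i x) else x = 0.

Definition Pol x : Prop := exists n, pol n x.

Lemma ev_lin c x y m : ev (c *: x + y) m = c * ev x m + ev y m.
Proof. exact: act_lin. Qed.

Lemma ev0 m : ev 0 m = 0.
Proof. by have := ev_lin (-1) 0 0 m; rewrite scaler0 add0r mulN1r addNr. Qed.

Lemma evZ c x m : ev (c *: x) m = c * ev x m.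
Proof. by rewrite -[c *: x]addr0 ev_lin ev0 addr0. Qed.

Lemma evD x y m : ev (x + y) m = ev x m + ev y m.
Proof. by rewrite -[x]scale1r ev_lin mul1r scale1r. Qed.

Lemma evB x y m : ev (x - y) m = ev x m - ev y m.
Proof. by rewrite evD -scaleN1r evZ mulN1r. Qed.

Lemma ev_sum (T : Type) (r : seq T) (f : T -> L) m :
  ev (\sum_(t <- r) f t) m = \sum_(t <- r) ev (f t) m.
Proof. exact: (big_morph _ (fun x y => evD x y m) (ev0 m)). Qed.

Lemma ev1 m : ev 1 m = (m == 1)%:R.
Proof. exact: act_one. Qed.

Lemma ev_a i x m : ev (a i * x) m = if (m %% d == i)%N then ev x (m %/ d)%N else 0.
Proof. by rewrite /ev actM act_a. Qed.

Lemma ev_astar i x m : ev (a' i * x) m = ev x (m * d + i)%N.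
Proof. by rewrite /ev actM act_astar. Qed.

Lemma eps_lin c x y : eps (c *: x + y) = c * eps x + eps y.
Proof. exact: ev_lin. Qed.
Lemma eps1 : eps 1 = 1. Proof. by rewrite /eps ev1. Qed.
Lemma eps0 : eps 0 = 0. Proof. exact: ev0. Qed.

Lemma der_lin i c x y : der i (c *: x + y) = c *: der i x + der i y.
Proof.
rewrite /der eps_lin scalerDl -scalerA opprD addrACA -scalerBr mulrDr.
by rewrite scalerAr.
Qed.

Lemma der0 i : der i 0 = 0.
Proof. by rewrite /der eps0 scale0r subr0 mulr0. Qed.

Lemma der_scalar i c : der i c%:A = 0.
Proof. by rewrite /der -[c%:A]addr0 eps_lin eps1 eps0 addr0 mulr1 addr0 subrr mulr0. Qed.

Lemma eps_der x : x = (eps x)%:A + \sum_i a i * der i x.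
Proof.
rewrite /der; under eq_bigr do rewrite mulrA.
by rewrite -mulr_suml sum_a_astar mul1r addrC subrK.
Qed.

Lemma astar_der i x : a' i * x = der i x + eps x *: a' i.
Proof. by rewrite /der mulrBr -scalerAr mulr1 subrK. Qed.

Lemma pol0 n : pol n 0.
Proof. by elim: n => //= n IHn i; rewrite der0. Qed.

Lemma pol_lin n c x y : pol n x -> pol n y -> pol n (c *: x + y).
Proof.
elim: n x y => [|n IHn] x y /=; first by move=> -> ->; rewrite scaler0 addr0.
by move=> px py i; rewrite der_lin; apply: IHn.
Qed.

Lemma polZ n c x : pol n x -> pol n (c *: x).
Proof. by move=> px; rewrite -[c *: x]addr0; apply: pol_lin => //; apply: pol0. Qed.

Lemma polD n x y : pol n x -> pol n y -> pol n (x + y).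
Proof. by move=> px; rewrite -[x]scale1r; apply: pol_lin. Qed.

Lemma pol_sum n (T : eqType) (r : seq T) (P : pred T) (f : T -> L) :
  (forall t, t \in r -> P t -> pol n (f t)) -> pol n (\sum_(t <- r | P t) f t).
Proof.
move=> pf; rewrite big_seq_cond; apply: big_ind; first exact: pol0.
  by move=> *; apply: polD.
by move=> t /andP[]; apply: pf.
Qed.

Lemma polW m n x : (m <= n)%N -> pol m x -> pol n x.
Proof.
elim: m n x => [|m IHm] [|n] x //=; first by move=> _ ->; apply: (pol0 n.+1).
by move=> mn px i; apply: IHm mn _.
Qed.

Lemma pol_scalar c : pol 1 c%:A.
Proof. by move=> i; rewrite /= der_scalar. Qed.

Lemma pol_ev0 n x : pol n x -> ev x 0 = 0.
Proof.
elim: n x => [|n IHn] x /=; first by move=> ->; apply: ev0.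
move=> px; rewrite [x]eps_der evD evZ ev1 mulr0 add0r ev_sum big1 // => i _.
by rewrite ev_a div0n IHn ?if_same.
Qed.

Lemma eps_a n i x : pol n x -> eps (a i * x) = 0.
Proof. by move=> px; rewrite /eps ev_a divn_small // (pol_ev0 px) if_same. Qed.

Lemma pol_a n i x : pol n x -> pol n.+1 (a i * x).
Proof.
move=> px j; rewrite /der (eps_a i px) scale0r subr0 mulrA astar_a.
by case: eqP => _; rewrite ?mul1r // mul0r; apply: pol0.
Qed.

Lemma polM m n x y : pol m x -> pol n y -> pol (m + n).-1 (x * y).
Proof.
case: n => [|n] px; first by move=> ->; rewrite mulr0; apply: pol0.
rewrite addnS succnK; elim: m x px => [|m IHm] x px py.
  by rewrite (px : x = 0) mul0r; apply: pol0.
rewrite [x]eps_der mulrDl -scalerAl mul1r; apply: polD.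
  by apply: polZ; apply: (polW _ py); rewrite addSn ltnS leq_addl.
rewrite mulr_suml; apply: pol_sum => i _ _; rewrite -mulrA.
by apply: pol_a; apply: IHm.
Qed.

(** The words in the [a_i] are linearly independent: distinct words send the delta sequence at 1 to
    deltas at distinct positive indices. *)
Lemma pol_ev_eq0 n x : pol n x -> (forall m, (0 < m)%N -> ev x m = 0) -> x = 0.
Proof.
elim: n x => [|n IHn] x //= px x0; rewrite [x]eps_der.
have eps_x : eps x = 0 by apply: x0.
rewrite eps_x scale0r add0r big1 // => i _; rewrite (IHn _ (px i)) ?mulr0 // => m m0.
rewrite /der eps_x scale0r subr0 ev_astar x0 // addn_gt0 muln_gt0 m0.
by rewrite d_gt0.
Qed.

Lemma ev_wstar w x : (forall m, (0 < m)%N -> ev x m = 0) ->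
  forall m, (0 < m)%N -> ev (S w * x) m = 0.
Proof.
move=> x0; elim/last_ind: w => [|w i IHw] m m0; first by rewrite wstar_nil mul1r x0.
by rewrite wstar_rcons -mulrA ev_astar IHw // addn_gt0 muln_gt0 m0 d_gt0.
Qed.

Lemma ev_wstar_derw w x m : (0 < m)%N -> ev (S w * x) m = ev (derw w x) m.
Proof.
elim: w x => [|i w IHw] x m0; first by rewrite wstar_nil mul1r.
rewrite /= -IHw // wstar_cons -mulrA astar_der mulrDr evD -scalerAr evZ.
rewrite [X in eps x * X]ev_wstar ?mulr0 ?addr0 // => n n0.
(* For positive [n], the index [n * d + i] is at least 2, so it misses the support of the delta
   sequence at 1; this is where [d_ge2] enters. *)
rewrite -[a' i]mulr1 ev_astar ev1; case: eqP => // e.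
have : (2 <= n * d + i)%N by rewrite (leq_trans d_ge2) // (leq_trans _ (leq_addr _ _)) // leq_pmull.
by rewrite e.
Qed.

Lemma pol_derw k w x : pol (size w + k) x -> pol k (derw w x).
Proof. by elim: w x => //= i w IHw x px; apply: IHw. Qed.

(** The two sides differ by star words, which are invisible at positive indices; when both are
    polynomial the difference must vanish by [pol_ev_eq0]. Knowing only that [S w * x] is a
    polynomial thus yields a bound on its degree. *)
Lemma wstar_derw n k w x : pol n x -> pol k (S w * x) -> S w * x = derw w x.
Proof.
move=> px pwx; apply/eqP; rewrite -subr_eq0; apply/eqP.
apply: (@pol_ev_eq0 (maxn k n)) => [|m m0]; last by rewrite evB ev_wstar_derw ?subrr.
rewrite -scaleN1r addrC; apply: pol_lin; last by apply: (polW _ pwx); rewrite leq_maxl.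
by apply: pol_derw; apply: (polW _ px); apply: leq_trans (leq_maxr k n) (leq_addl _ _).
Qed.

(** On a polynomial, the part formed by the words of length less than [n]. *)
Fixpoint trunc n x : L :=
  if n is n'.+1 then (eps x)%:A + \sum_i a i * trunc n' (der i x) else 0.

Lemma wstar_trunc w x : S w * x = derw w x + S w * trunc (size w) x.
Proof.
elim: w x => [|i w IHw] x; first by rewrite wstar_nil mulr0 addr0 mul1r.
rewrite wstar_cons -!mulrA astar_der mulrDr IHw /= mulrDr mulr_sumr.
rewrite (bigD1 i) //= mulrA astar_a eqxx mul1r big1 ?addr0 => [|j ji].
  by rewrite mulrDr -!scalerAr mulr1 -addrA [S w * trunc _ _ + _]addrC.
by rewrite mulrA astar_a eq_sym (negPf ji) mul0r.
Qed.

Lemma trunc0 n : trunc n 0 = 0.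
Proof.
elim: n => //= n IHn; rewrite eps0 scale0r add0r big1 // => i _.
by rewrite der0 IHn mulr0.
Qed.

Lemma pol_trunc m n x : pol m x -> pol (minn n m) (trunc n x).
Proof.
elim: n m x => [|n IHn] [|m] x //=; first by move=> ->; apply: (trunc0 n.+1).
rewrite minnSS => px; apply: polD.
  by apply: (@polW 1) => //; apply: pol_scalar.
by apply: pol_sum => i _ _; apply: pol_a; apply: IHn.
Qed.

Lemma npol_derw n x : ~ pol n x -> exists2 w, size w = n & derw w x <> 0.
Proof.
elim: n x => [|n IHn] x /=; first by move=> x0; exists [::].
by move=> /existsNP[i /IHn[w <- wx]]; exists (i :: w).
Qed.

Lemma pol_degree x : Pol x -> x <> 0 -> exists w, [/\ derw w x <> 0,
  pol (size w).+1 x & forall n, pol n x -> (size w < n)%N].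
Proof.
move=> [n0 pn0] x0; have : exists n, `[< pol n x >] by exists n0; apply/asboolP.
case/ex_minnP => -[|n] /asboolP pn min_n //.
have [|w wn wx] := @npol_derw n x.
  by move=> /asboolP/min_n; rewrite ltnn.
by exists w; rewrite wn; split=> // m /asboolP/min_n.
Qed.

Lemma pol1_scalar x : pol 1 x -> x = (eps x)%:A.
Proof.
by move=> px; rewrite {1}[x]eps_der big1 ?addr0 // => i _; rewrite (px i) mulr0.
Qed.
Lemma Pol0 : Pol 0. Proof. by exists 0%N. Qed.

Lemma Pol_scalar c : Pol c%:A.
Proof. by exists 1%N; apply: pol_scalar. Qed.

Lemma Pol1 : Pol 1.
Proof. by rewrite -[1]scale1r; apply: Pol_scalar. Qed.

Lemma PolD x y : Pol x -> Pol y -> Pol (x + y).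
Proof.
move=> [m px] [n py]; exists (maxn m n).
by apply: polD; [apply: (polW _ px)|apply: (polW _ py)]; rewrite ?leq_maxl ?leq_maxr.
Qed.

Lemma PolZ c x : Pol x -> Pol (c *: x).
Proof. by move=> [m px]; exists m; apply: polZ. Qed.

Lemma PolN x : Pol x -> Pol (- x).
Proof. by rewrite -scaleN1r; apply: PolZ. Qed.

Lemma PolM x y : Pol x -> Pol y -> Pol (x * y).
Proof. by move=> [m px] [n py]; exists (m + n).-1; apply: polM. Qed.

Lemma Pol_sum (T : eqType) (r : seq T) (P : pred T) (f : T -> L) :
  (forall t, t \in r -> P t -> Pol (f t)) -> Pol (\sum_(t <- r | P t) f t).
Proof.
move=> pf; rewrite big_seq_cond; apply: big_ind; [exact: Pol0|exact: PolD|].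
by move=> t /andP[]; apply: pf.
Qed.

Lemma Pol_wval w : Pol (V w).
Proof.
elim: w => [|i w [n IHw]]; first by rewrite wval_nil; apply: Pol1.
by exists n.+1; rewrite wval_cons; apply: pol_a.
Qed.

Lemma Pol_derw w x : Pol x -> Pol (derw w x).
Proof.
by move=> [n px]; exists n; apply/pol_derw/(polW _ px)/leq_addl.
Qed.

Lemma Pol_leaf_ortho s v w : ordered_leaf_set s -> v \in s -> w \in s ->
  Pol (S v * V w).
Proof.
move=> s_leaf vs ws; rewrite (leaf_ortho s_leaf) //.
by case: eqP => _; [apply: Pol1|apply: Pol0].
Qed.

(** Degree plus one, with value 0 at 0 and, by default, at non-polynomials. *)
Definition sz x : nat :=
  if pselect (exists n, `[< pol n x >]) is left ex then ex_minn ex else 0.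

Lemma sz_pol x : Pol x -> pol (sz x) x.
Proof.
move=> [n px]; rewrite /sz; case: pselect => [ex|[]]; last by exists n; apply/asboolP.
by case: ex_minnP => m /asboolP.
Qed.

Lemma sz_min n x : pol n x -> (sz x <= n)%N.
Proof.
move=> px; rewrite /sz; case: pselect => // ex; case: ex_minnP => m _; apply.
exact/asboolP.
Qed.

Lemma sz_derw x : Pol x -> x != 0 ->
  exists2 w, (size w).+1 = sz x & derw w x <> 0.
Proof.
move=> px x0; have [w [wx pw min_w]] := pol_degree px (elimN eqP x0).
exists w => //; apply/eqP; rewrite eqn_leq (min_w _ (sz_pol px)).
exact: sz_min.
Qed.

(** * Polynomial matrices in leaf frames and their elementary operations *)

Definition frame_pol s1 s2 x := forall v w, v \in s1 -> w \in s2 ->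
  Pol (S v * x * V w).

Lemma frame_polM s1 s2 s3 x y : ordered_leaf_set s2 ->
  frame_pol s1 s2 x -> frame_pol s2 s3 y -> frame_pol s1 s3 (x * y).
Proof.
move=> s2_leaf px py v w vs ws; rewrite [y](leaf_expandl s2_leaf).
rewrite !mulr_sumr mulr_suml; apply: Pol_sum => u us _.
have -> : S v * (x * (V u * (S u * y))) * V w =
   (S v * x * V u) * (S u * y * V w) by rewrite !mulrA.
by apply: PolM; [apply: px|apply: py].
Qed.

(* The invertible polynomial matrices, in the frame s, that differ from the   *)
(* identity only in rows and columns of t.                                    *)
Definition GE s (t : seq word) x := [/\ G x, x \is a GRing.unit, frame_pol s s x,
  frame_pol s s x^-1 &
  forall w, w \in s -> w \notin t -> x * V w = V w /\ S w * x = S w].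

Lemma GE_mul s t x y : ordered_leaf_set s -> GE s t x -> GE s t y ->
  GE s t (x * y).
Proof.
move=> s_leaf [Gx Ux px pVx fx] [Gy Uy py pVy fy]; split.
- exact: G_mul.
- by rewrite unitrMl.
- exact: (frame_polM s_leaf).
- by rewrite invrM //; apply: (frame_polM s_leaf).
- move=> w ws wt; have [[xw wx] [yw wy]] := (fx w ws wt, fy w ws wt).
  by rewrite -mulrA yw xw mulrA wx wy.
Qed.

Lemma GE_intro s t x y : ordered_leaf_set s -> G (1 + x) ->
  (1 + x) * (1 + y) = 1 -> (1 + y) * (1 + x) = 1 ->
  frame_pol s s x -> frame_pol s s y ->
  (forall w, w \in s -> w \notin t -> x * V w = 0 /\ S w * x = 0) ->
  GE s t (1 + x).
Proof.
move=> s_leaf Gx xy yx px py fx.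
have Ux : 1 + x \is a GRing.unit by apply/unitrP; exists (1 + y).
have p1 z : frame_pol s s z -> frame_pol s s (1 + z).
  move=> pz v w vs ws; rewrite mulrDr mulrDl mulr1.
  by apply: PolD; [apply: Pol_leaf_ortho vs ws|apply: pz].
split=> //; first exact: p1.
  have -> : (1 + x)^-1 = 1 + y by rewrite -[RHS](mulKr Ux) xy mulr1.
  exact: p1.
move=> w ws wt; have [xw wx] := fx w ws wt.
by rewrite mulrDl mulrDr xw wx mul1r mulr1 !addr0.
Qed.

Lemma GE_row s t v x : ordered_leaf_set s -> v \in s -> v \in t ->
  x * V v = 0 -> (forall w, w \in s -> Pol (x * V w)) ->
  (forall w, w \in s -> w \notin t -> x * V w = 0) -> GE s t (1 + V v * x).
Proof.
move=> s_leaf vs vt xv px xt.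
have p1 y : (forall w, w \in s -> Pol (y * V w)) -> frame_pol s s (V v * y).
  move=> py u w us ws; rewrite mulrA -mulrA; apply: PolM; last exact: py.
  exact: Pol_leaf_ortho us vs.
apply: (@GE_intro _ _ _ (V v * - x)) => //.
- exact: G_row_transvection s_leaf vs xv.
- by rewrite transvectionMl // subrr mulr0 addr0.
- by rewrite transvectionMl ?mulNr ?xv ?oppr0 // addNr mulr0 addr0.
- exact: p1.
- by apply: p1 => w ws; rewrite mulNr; apply/PolN/px.
move=> w ws wt; rewrite -mulrA xt // mulr0 mulrA (leaf_ortho s_leaf) //.
by case: eqP wt => [->|_ _]; rewrite ?vt // mul0r.
Qed.

Lemma GE_col s t v x : ordered_leaf_set s -> v \in s -> v \in t ->
  S v * x = 0 -> (forall w, w \in s -> Pol (S w * x)) ->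
  (forall w, w \in s -> w \notin t -> S w * x = 0) -> GE s t (1 + x * S v).
Proof.
move=> s_leaf vs vt xv px xt.
have p1 y : (forall w, w \in s -> Pol (S w * y)) -> frame_pol s s (y * S v).
  move=> py u w us ws; rewrite mulrA -mulrA; apply: PolM; first exact: py.
  exact: Pol_leaf_ortho vs ws.
apply: (@GE_intro _ _ _ (- x * S v)) => //.
- exact: G_col_transvection s_leaf vs xv.
- by rewrite transvectionMr ?mulrN ?xv ?oppr0 // subrr mul0r addr0.
- by rewrite transvectionMr // addNr mul0r addr0.
- exact: p1.
- by apply: p1 => w ws; rewrite mulrN; apply/PolN/px.
move=> w ws wt; rewrite mulrA xt // mul0r -mulrA (leaf_ortho s_leaf) //.
by case: eqP wt => [<-|_ _]; rewrite ?vt // mulr0.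
Qed.

Lemma GE_scaling s t v (c : K) : ordered_leaf_set s -> v \in s -> v \in t ->
  c != 0 -> GE s t (1 + (c - 1) *: (V v * S v)).
Proof.
move=> s_leaf vs vt c0.
have mul (b b' : K) : (1 + (b - 1) *: (V v * S v)) * (1 + (b' - 1) *: (V v * S v)) =
    1 + (b * b' - 1) *: (V v * S v).
  rewrite mulrDl mul1r mulrDr mulr1 -scalerAl -scalerAr scalerA.
  rewrite -mulrA (mulrA (S v)) wstarK mul1r -addrA -!scalerDl; congr (_ + _ *: _).
  by ring.
have p1 (b : K) : frame_pol s s (b *: (V v * S v)).
  move=> u w us ws; rewrite -scalerAr -scalerAl; apply: PolZ.
  by rewrite mulrA -(mulrA (S u * V v)); apply: PolM; apply: (Pol_leaf_ortho s_leaf).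
apply: (@GE_intro _ _ _ ((c^-1 - 1) *: (V v * S v))) => //.
- exact: G_scaling s_leaf vs c0.
- by rewrite mul mulfV // subrr scale0r addr0.
- by rewrite mul mulVf // subrr scale0r addr0.
move=> w ws wt; have vw : (v == w) = false.
  by apply/eqP => vw; rewrite -vw vt in wt.
rewrite -scalerAl -mulrA (leaf_ortho s_leaf) // vw -scalerAr mulrA.
by rewrite (leaf_ortho s_leaf) // eq_sym vw mulr0 mul0r scaler0.
Qed.

(** * Reduction of a left-invertible polynomial column *)

Lemma frame_mulr s x y v : ordered_leaf_set s -> frame_pol s s y ->
  (forall w, w \in s -> Pol (x * V w)) -> v \in s -> Pol (x * y * V v).
Proof.
move=> s_leaf py px vs; rewrite [y](leaf_expandl s_leaf) mulr_sumr mulr_suml.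
apply: Pol_sum => u us _.
have -> : x * (V u * (S u * y)) * V v = (x * V u) * (S u * y * V v).
  by rewrite !mulrA.
by apply: PolM; [apply: px|apply: py].
Qed.

Lemma frame_mull s x y v : ordered_leaf_set s -> frame_pol s s y ->
  (forall w, w \in s -> Pol (S w * x)) -> v \in s -> Pol (S v * (y * x)).
Proof.
move=> s_leaf py px vs; rewrite [x](leaf_expandl s_leaf) !mulr_sumr.
apply: Pol_sum => u us _.
have -> : S v * (y * (V u * (S u * x))) = (S v * y * V u) * (S u * x).
  by rewrite !mulrA.
by apply: PolM; [apply: py|apply: px].
Qed.

(** A nonzero constant entry is scaled to 1, then a single column transvection clears the others. *)
Lemma column_pivot s t x w : ordered_leaf_set s -> w \in s -> w \in t ->
  (forall v, v \in s -> Pol (S v * x)) ->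
  (forall v, v \in s -> v \notin t -> S v * x = 0) ->
  pol 1 (S w * x) -> S w * x != 0 ->
  exists2 g, GE s t g & g * x = V w.
Proof.
move=> s_leaf ws wt px xt /pol1_scalar; set c := eps _ => xw.
rewrite xw scaler_eq0 oner_eq0 orbF => c0.
pose g1 : L := 1 + (c^-1 - 1) *: (V w * S w); pose x1 : L := g1 * x.
have g1GE : GE s t g1 by apply: GE_scaling; rewrite ?invr_neq0.
have g1x v : v \in s -> S v * x1 = if v == w then 1 else S v * x.
  move=> vs; rewrite /x1 /g1 mulrDl mul1r mulrDr -scalerAl -scalerAr -mulrA.
  rewrite (mulrA (S v)) (leaf_ortho s_leaf) //; case: eqP => [->|_]; last first.
    by rewrite mul0r scaler0 addr0.
  by rewrite mul1r xw scalerA -scalerDl mulrBl mulVf // mul1r addrC subrK scale1r.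
exists ((1 + (V w - x1) * S w) * g1); last first.
  rewrite -mulrA mulrDl mul1r -mulrA -/x1 g1x // eqxx mulr1.
  by rewrite addrC subrK.
apply: GE_mul => //; apply: GE_col => // [|v vs|v vs vt].
- by rewrite mulrBr wstarK g1x // eqxx subrr.
- rewrite mulrBr; apply: PolD; first exact: (Pol_leaf_ortho s_leaf).
  by apply: PolN; rewrite g1x //; case: eqP => _; [apply: Pol1|apply: px].
rewrite mulrBr g1x // (leaf_ortho s_leaf) //.
by case: eqP vt => [->|_ /xt ->//]; rewrite ?wt // subrr.
Qed.

(* The weak algorithm of the free algebra: among the products                 *)
(* (y V_v) (S_v x) of maximal degree take one, v = i, with S_i x of maximal    *)
(* degree, and strip from y x = 1 a leading word w of y V_i, on the left.     *)
Lemma column_lower s t x y : ordered_leaf_set s -> {subset t <= s} -> uniq t ->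
  (forall v, v \in s -> Pol (S v * x)) -> (forall v, v \in s -> Pol (y * V v)) ->
  (forall v, v \in s -> v \notin t -> S v * x = 0) -> y * x = 1 ->
  (forall v, v \in t -> S v * x != 0 -> ~ pol 1 (S v * x)) ->
  exists i g, [/\ i \in t, GE s t g, (sz (S i * (g * x)) < sz (S i * x))%N &
    forall v, v \in t -> v != i -> S v * (g * x) = S v * x].
Proof.
move=> s_leaf ts ut px py xt yx nx.
have sum1 z : z = \sum_(v <- t) z * (y * V v) * (S v * x).
  rewrite -{1}[z]mulr1 -yx {1}[x](leaf_expandl s_leaf) !mulr_sumr.
  have [us _] := s_leaf.
  rewrite (bigID (mem t)) /= [X in _ + X]big_seq_cond [X in _ + X]big1 ?addr0; last first.
    by move=> v /andP[vs vt]; rewrite (xt _ vs vt) !mulr0.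
  rewrite -big_filter; apply: etrans (perm_big _ _) _; last first.
    by apply: eq_bigr => v _; rewrite !mulrA.
  apply: uniq_perm; rewrite ?filter_uniq // => v; rewrite mem_filter andbC.
  by apply: andb_idl => /ts.
pose P v := (S v * x != 0) && (y * V v != 0).
pose deg v := (sz (y * V v) + sz (S v * x))%N.
have Pt : has P t.
  apply/negPn/negP => /hasPn nP; move/eqP: (oner_neq0 L); apply.
  rewrite (sum1 1) big_seq big1 // => v /nP; rewrite /P negb_and !negbK mul1r.
  by case/orP => /eqP->; rewrite ?mulr0 ?mul0r.
have [i1 /andP[i1t Pi1] max_i1] := seq_argmax deg Pt.
have Pdt : has (fun v => P v && (deg v == deg i1)) t.
  by apply/hasP; exists i1 => //; rewrite Pi1 eqxx.
have [i /andP[it /andP[Pi /eqP deg_i]] max_i] := seq_argmax (fun v => sz (S v * x)) Pdt.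
have {}max_i1 v : v \in t -> P v -> (deg v <= deg i)%N by rewrite deg_i; apply: max_i1.
have {}max_i v : v \in t -> P v -> deg v = deg i -> (sz (S v * x) <= sz (S i * x))%N.
  by move=> vt Pv degv; apply: max_i; rewrite // Pv degv deg_i eqxx.
have is_ := ts i it; have /andP[xi0 yi0] := Pi.
have [w size_w yw0] := sz_derw (py i is_) yi0.
have szx : (2 <= sz (S i * x))%N.
  rewrite leqNgt ltnS; apply/negP => sz1; apply: (nx i it xi0).
  by apply: polW sz1 _; apply/sz_pol/px.
pose b v := derw w (y * V v).
have pb v : v \in t -> Pol (b v) by move=> /ts/py; apply: Pol_derw.
have [c c0 bi] : exists2 c, c != 0 & b i = c%:A.
  have : pol 1 (b i) by apply: pol_derw; rewrite addn1 size_w; apply/sz_pol/py.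
  move/pol1_scalar => bi; exists (eps (b i)) => //.
  by apply: contra_notN yw0 => /eqP e0; rewrite -/(b i) bi e0 scale0r.
(* Multiplying [y * x = 1] by [S w] and splitting each [y * V v] at length [size w] gives
   [S w * h = r]. Both [h] and [r] are polynomial, so [r] is [derw w h] and its degree is that of
   [h] lowered by [size w]. *)
pose r := \sum_(v <- t) b v * (S v * x).
have pr : pol (sz (S i * x)).-1 r.
  pose h := 1 - \sum_(v <- t) trunc (size w) (y * V v) * (S v * x).
  have rE : S w * h = r.
    rewrite mulrBr mulr1 mulr_sumr {1}(sum1 (S w)) -sumrB; apply: eq_bigr => v _.
    by rewrite !mulrA -!mulrBl -(mulrA (S w)) {1}(wstar_trunc w) addrK.
  have ph : pol (size w + (sz (S i * x)).-1) h.
    rewrite /h addrC -scaleN1r; apply: pol_lin; last first.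
      rewrite -[1]scale1r; apply: (@polW 1); last exact: pol_scalar.
      by move: szx; case: (sz _) => [|[|n]] // _; rewrite addnS.
    apply: pol_sum => v vt _; have vs := ts v vt.
    have [Pv|] := boolP (P v); last first.
      rewrite negb_and !negbK => /orP[/eqP->|/eqP->].
        by rewrite mulr0; apply: pol0.
      by rewrite trunc0 mul0r; apply: pol0.
    apply: (polW _ (polM (pol_trunc (size w) (sz_pol (py v vs))) (sz_pol (px v vs)))).
    (* If [y * V v] is not truncated, exceeding the bound would force [v] to attain the maximal
       total degree with an entry [S v * x] larger than that of [i], against the choice of [i]. If
       it is truncated, it is at least as large as [y * V i], and maximality of the total degree
       bounds [S v * x]. *)
    exact: (degree_drop szx size_w (max_i1 v vt Pv) (max_i v vt Pv)).
  rewrite -rE; have [n pn] : Pol (S w * h).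
    rewrite rE; apply: Pol_sum => v vt _; apply: PolM; first exact: pb.
    exact/px/ts.
  by rewrite (wstar_derw ph pn); apply: pol_derw.
(* Since [b i] is the nonzero constant [c], the relation defining [r] expresses [S i * x + q * x] as
   [c^-1 *: r], of smaller degree than [S i * x]. *)
pose q := \sum_(v <- t | v != i) c^-1 *: (b v * S v).
have qV v : v \in s -> q * V v = if (v \in t) && (v != i) then c^-1 *: b v else 0.
  move=> vs; rewrite /q mulr_suml.
  have qv u : u \in s -> c^-1 *: (b u * S u) * V v = if u == v then c^-1 *: b v else 0.
    move=> us; rewrite -scalerAl -mulrA (leaf_ortho s_leaf) //.
    by case: eqP => [->|_]; rewrite ?mulr1 // mulr0 scaler0.
  case: ifP => [/andP[vt vi]|vti].
    rewrite big_mkcond (bigD1_seq v) //= vi qv // eqxx big_seq_cond.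
    rewrite big1 ?addr0 // => u /andP[/ts us uv]; rewrite qv // (negPf uv).
    by rewrite if_same.
  rewrite big_seq_cond big1 // => u /andP[tu ui]; rewrite qv ?ts //.
  by case: eqP => // uv; rewrite -uv tu ui in vti.
exists i, (1 + V i * q).
have gx v : v \in s -> S v * ((1 + V i * q) * x) = S v * x + (v == i)%:R * (q * x).
  by move=> vs; rewrite mulrDl mul1r mulrDr -mulrA (mulrA (S v)) (leaf_ortho s_leaf).
split=> //.
- apply: GE_row => // [|v vs|v vs vt].
  + by rewrite qV // eqxx andbF.
  + rewrite qV //; case: ifP => [/andP[vt _]|_]; last exact: Pol0.
    by apply: PolZ; apply: pb.
  + by rewrite qV // (negPf vt).
- rewrite gx // eqxx mul1r.
  have -> : S i * x + q * x = c^-1 *: r.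
    rewrite /r (bigD1_seq i) //= bi scalerDr -scalerAl mul1r scalerA mulVf // scale1r.
    congr (_ + _); rewrite /q mulr_suml scaler_sumr; apply: eq_bigr => v _.
    by rewrite -scalerAl mulrA.
  by rewrite (leq_ltn_trans (sz_min (polZ _ pr))) //; move: szx; case: (sz _).
by move=> v vt vi; rewrite gx ?ts // (negPf vi) mul0r addr0.
Qed.

(** Induction on the total size of the entries: either some entry is a nonzero constant and serves
    as pivot, or one entry can be lowered, [y] absorbing the inverse operation. *)
Lemma column_reduce s t x y : ordered_leaf_set s -> {subset t <= s} -> uniq t ->
  (forall v, v \in s -> Pol (S v * x)) -> (forall v, v \in s -> Pol (y * V v)) ->
  (forall v, v \in s -> v \notin t -> S v * x = 0) -> y * x = 1 ->
  exists g w, [/\ GE s t g, w \in t & g * x = V w].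
Proof.
move=> s_leaf ts ut; have [n] := ubnP (\sum_(v <- t) sz (S v * x))%N.
elim: n x y => // n IHn x y; rewrite ltnS => sz_x px py xt yx.
have [[w wt [xw0 xw1]]|nx] :=
    pselect (exists2 w, w \in t & S w * x != 0 /\ pol 1 (S w * x)).
  by have [g gGE gx] := column_pivot s_leaf (ts w wt) wt px xt xw1 xw0; exists g, w.
have [|i [g [it gGE gi gv]]] := column_lower s_leaf ts ut px py xt yx.
  by move=> v vt xv0 xv1; apply: nx; exists v.
have [_ Ug pg pVg fg] := gGE.
have [|||||g' [w [g'GE wt g'x]]] := IHn (g * x) (y * g^-1).
- apply: leq_trans sz_x; rewrite (bigD1_seq i) //= [X in (_ < X)%N](bigD1_seq i) //=.
  rewrite -addSn leq_add // big_seq_cond [leqRHS]big_seq_cond.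
  by apply: leq_sum => v /andP[vt vi]; rewrite gv.
- by move=> v vs; apply: (frame_mull s_leaf).
- by move=> v vs; apply: (frame_mulr s_leaf).
- by move=> v vs vt; have [_ vg] := fg v vs vt; rewrite mulrA vg xt.
- by rewrite -mulrA mulKr.
by exists (g' * g), w; split=> //; [apply: GE_mul|rewrite -mulrA].
Qed.

(** * Invertible polynomial matrices lie in the group *)

Lemma frame_pol_mem s1 s2 t1 t2 x : s1 =i t1 -> s2 =i t2 ->
  frame_pol s1 s2 x -> frame_pol t1 t2 x.
Proof. by move=> st1 st2 px v w; rewrite -st1 -st2; apply: px. Qed.

(* D lists the pairs (row, column) of leaves where x is already reduced.      *)
Lemma G_polynomial_matched (D : seq (word * word)) (r s : seq word) x :
  ordered_leaf_set (unzip1 D ++ r) -> ordered_leaf_set (unzip2 D ++ s) ->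
  x \is a GRing.unit -> frame_pol (unzip1 D ++ r) (unzip2 D ++ s) x ->
  frame_pol (unzip2 D ++ s) (unzip1 D ++ r) x^-1 ->
  (forall p, p \in D -> x * V p.2 = V p.1 /\ S p.1 * x = S p.2) -> G x.
Proof.
elim: s D r x => [|b s IHs] D r x r_leaf s_leaf Ux px pVx xD.
  have [ur _] := r_leaf.
  (* With all columns matched, a remaining row of [x] would be zero, contradicting invertibility. *)
  have r0 : r = [::].
    case: r ur r_leaf {px pVx} => // c r ur r_leaf; exfalso.
    have Sc : S c * x = 0.
      apply: (leaf_extr s_leaf) => w; rewrite cats0 => /mapP[p pD ->].
      rewrite mul0r -mulrA (xD p pD).1 (leaf_ortho r_leaf) ?mem_cat ?mem_head ?orbT //.
        case: eqP => // cp; move: ur; rewrite cat_uniq /= => /and3P[_ /norP[/negP[]]].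
        by rewrite cp; apply/mapP; exists p.
      by apply/orP; left; apply/mapP; exists p.
    by move/eqP: (oner_neq0 L); apply; rewrite -(wstarK c) -[S c](mulrK Ux) Sc !mul0r.
  rewrite r0 !cats0 {r r0 ur px pVx} in r_leaf s_leaf.
  have -> : x = umx (map_tuple fst (in_tuple D)) 1%:M (map_tuple snd (in_tuple D)).
    apply: (leaf_extr s_leaf) => w /(tnthP (map_tuple snd (in_tuple D)))[j ->].
    rewrite umx_val // (bigD1 j) //= mxE eqxx scale1r big1 ?addr0.
      by rewrite !tnth_map (xD _ (mem_tnth j (in_tuple D))).1.
    by move=> i ij; rewrite mxE (negPf ij) scale0r.
  apply: G_umx => //; last exact: unitmx1.
  by have := ordered_leaf_set_gt0 d_gt0 s_leaf; rewrite size_map.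
have [[ur _] [us _]] := (r_leaf, s_leaf).
have bs : b \in unzip2 D ++ b :: s by rewrite mem_cat mem_head orbT.
have D1 p : p \in D -> p.1 \in unzip1 D ++ r.
  by move=> pD; rewrite mem_cat; apply/orP; left; apply/mapP; exists p.
have D2 p : p \in D -> p.2 \in unzip2 D ++ b :: s.
  by move=> pD; rewrite mem_cat; apply/orP; left; apply/mapP; exists p.
have rD p : p \in D -> p.1 \notin r.
  move=> pD; apply/negP => pr; move: ur; rewrite cat_uniq => /and3P[_ /hasPn/(_ _ pr)].
  by move=> /negP[]; apply/mapP; exists p.
have sD p : p \in D -> p.2 \notin b :: s.
  move=> pD; apply/negP => ps; move: us; rewrite cat_uniq => /and3P[_ /hasPn/(_ _ ps)].
  by move=> /negP[]; apply/mapP; exists p.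
have Dr v : v \in unzip1 D ++ r -> v \notin r -> exists2 p, p \in D & v = p.1.
  by rewrite mem_cat => /orP[/mapP[p pD ->]|->//]; exists p.
have Ds v : v \in unzip2 D ++ b :: s -> v \notin b :: s -> exists2 p, p \in D & v = p.2.
  by rewrite mem_cat => /orP[/mapP[p pD ->]|->//]; exists p.
have sub_r : {subset r <= unzip1 D ++ r} by move=> v; rewrite mem_cat => ->; rewrite orbT.
have bD p : p \in D -> (b == p.2) = false.
  by move=> /sD; rewrite inE eq_sym; case: eqP.
(* Column [b] of [x] is left-invertible by row [b] of the inverse and vanishes on the matched rows,
   so its reduction stays within [r] and preserves the pairs of [D]. *)
have [|||||g [w [gGE wr gx]]] := @column_reduce _ r (x * V b) (S b * x^-1) r_leaf sub_r.
- by move: ur; rewrite cat_uniq => /and3P[].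
- by move=> v vr; rewrite mulrA; apply: px.
- by move=> v vr; apply: pVx.
- move=> v vr vnr; have [p pD ->] := Dr v vr vnr.
  by rewrite mulrA (xD p pD).2 (leaf_ortho s_leaf) ?D2 // eq_sym bD.
- by rewrite mulrA mulrVK // wstarK.
have [Gg Ug pg pVg fg] := gGE.
have gD p : p \in D -> g * V p.1 = V p.1 /\ S p.1 * g = S p.1.
  by move=> pD; apply: fg; [apply: D1|apply: rD].
have pgx : frame_pol (unzip1 D ++ r) (unzip2 D ++ b :: s) (g * x).
  exact: (frame_polM r_leaf).
have w_r := sub_r w wr.
have wD p : p \in D -> (w == p.1) = false.
  by move=> pD; apply/eqP => wp; have := rD p pD; rewrite -wp wr.
(* With 1 at position [(w, b)], right multiplication by [1 + V b * q] replaces row [w] by [S b], so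
   [(w, b)] joins the matched pairs. *)
pose q : L := S b - S w * (g * x).
have qb : q * V b = 0 by rewrite mulrBl -!mulrA gx !wstarK subrr.
have [|v vs vns|Gh Uh ph pVh fh] :=
    @GE_row _ (b :: s) b q s_leaf bs (mem_head _ _) qb.
- move=> v vs; rewrite mulrBl; apply: PolD; first exact: (Pol_leaf_ortho s_leaf).
  by apply/PolN/pgx.
- have [p pD ->] := Ds v vs vns; rewrite mulrBl -!mulrA (xD p pD).1 (gD p pD).1.
  by rewrite (leaf_ortho s_leaf) ?D2 // (leaf_ortho r_leaf) ?D1 // bD // wD // subrr.
set h := 1 + V b * q in Gh Uh ph pVh fh.
have hD p : p \in D -> h * V p.2 = V p.2 /\ S p.2 * h = S p.2.
  by move=> pD; apply: fh; [apply: D2|apply: sD].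
have -> : x = g^-1 * (g * x * h) * h^-1 by rewrite mulrA mulKr // mulrK.
apply: (G_mul (G_mul (G_inv Gg) _) (G_inv Gh)).
have r_perm : perm_eq (unzip1 D ++ r) (unzip1 ((w, b) :: D) ++ rem w r).
  rewrite /= (perm_trans (perm_cat (perm_refl _) (perm_to_rem wr))) //.
  by rewrite -cat1s perm_catCA.
have s_perm : perm_eq (unzip2 D ++ b :: s) (unzip2 ((w, b) :: D) ++ s).
  by rewrite /= -cat1s perm_catCA.
apply: (IHs ((w, b) :: D) (rem w r)).
- exact: ordered_leaf_set_perm r_perm r_leaf.
- exact: ordered_leaf_set_perm s_perm s_leaf.
- by rewrite !unitrMl.
- apply: (frame_pol_mem (perm_mem r_perm) (perm_mem s_perm)).
  exact: (frame_polM s_leaf).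
- apply: (frame_pol_mem (perm_mem s_perm) (perm_mem r_perm)).
  rewrite !invrM ?unitrMl //; apply: (frame_polM s_leaf) => //.
  exact: (frame_polM r_leaf).
move=> p; rewrite inE => /orP[/eqP->|pD] /=; last first.
  rewrite -!mulrA (hD p pD).1 (xD p pD).1 (gD p pD).1; split=> //.
  by rewrite !mulrA (gD p pD).2 (xD p pD).2 (hD p pD).2.
have -> : g * x * h = g * x + V w * q by rewrite mulrDr mulr1 [_ * (V b * q)]mulrA -(mulrA g) gx.
rewrite mulrDl -(mulrA (V w)) qb mulr0 addr0 -mulrA gx; split=> //.
by rewrite mulrDr (mulrA (S w) (V w)) wstarK mul1r addrC subrK.
Qed.

Lemma G_polynomial s1 s2 x : ordered_leaf_set s1 -> ordered_leaf_set s2 ->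
  x \is a GRing.unit -> frame_pol s1 s2 x -> frame_pol s2 s1 x^-1 -> G x.
Proof. by move=> ? ? ? ? ?; apply: (@G_polynomial_matched [::] s1 s2). Qed.

(** * Clearing the denominators of the inverse *)

Lemma eps_sum (I : finType) (f : I -> L) :
  eps (\sum_i f i) = \sum_i eps (f i).
Proof. exact: ev_sum. Qed.

Lemma epsZ c x : eps (c *: x) = c * eps x.
Proof. exact: evZ. Qed.

Lemma Pol_der i x : Pol x -> Pol (der i x).
Proof. exact: (@Pol_derw [:: i]). Qed.

Lemma frame_umx n (A : n.-tuple word) (M : 'M[K]_n) : ordered_leaf_set A ->
  frame_pol A A (umx A M A).
Proof.
move=> A_leaf v w /(tnthP A)[i ->] wA; rewrite star_umx // mulr_suml.
apply: Pol_sum => j _ _; rewrite -scalerAl; apply: PolZ.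
exact: (Pol_leaf_ortho A_leaf (mem_tnth j A) wA).
Qed.

Lemma umx_frameE n1 n2 (A : n1.-tuple word) (B : n2.-tuple word) (M : 'M[K]_n1)
    (N : 'M[K]_n2) x i j : ordered_leaf_set A -> ordered_leaf_set B ->
  S (tnth A i) * (umx A M A * x * umx B N B) * V (tnth B j) =
  \sum_k \sum_l (M i k * N l j) *: (S (tnth A k) * x * V (tnth B l)).
Proof.
move=> A_leaf B_leaf; rewrite !mulrA star_umx // -mulrA umx_val // !mulr_suml.
apply: eq_bigr => k _; rewrite mulr_sumr; apply: eq_bigr => l _.
by rewrite -!scalerAl -scalerAr scalerA.
Qed.

(** Every word of [f] only lengthens the word between [z] and the end, so the words met by [z] all
    have length at least [m]. *)
Lemma Pol_right_ideal m z f (p u : word) : (forall w, (m <= size w)%N -> Pol (z * V w)) ->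
  Pol f -> (m <= size p + size u)%N -> Pol (z * V p * f * V u).
Proof.
move=> pz [n pf]; elim: n f p pf => [|n IHn] f p pf mpu.
  by rewrite pf mulr0 mul0r; apply: Pol0.
rewrite [f]eps_der mulrDr mulrDl mulr_sumr mulr_suml; apply: PolD.
  rewrite -scalerAr mulr1 -scalerAl -mulrA -wval_cat.
  by apply/PolZ/pz; rewrite size_cat.
apply: Pol_sum => i _ _; rewrite mulrA -(mulrA z) -wval_rcons.
by apply: IHn; [apply: pf|rewrite size_rcons addSn leqW].
Qed.

(* x^-1 has "denominators of length m". When m > 0, Gaussian elimination      *)
(* brings the constant terms of the matrix of x to the form pid_mx r; its     *)
(* rows of index at least r then have entries in the span of the a_i L, so    *)
(* these leaves can be expanded, which lowers m.                              *)
Lemma G_denominator m s1 s2 x : ordered_leaf_set s1 -> ordered_leaf_set s2 ->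
  x \is a GRing.unit -> frame_pol s1 s2 x ->
  (forall v w u, v \in s2 -> w \in s1 -> (m <= size u)%N ->
     Pol (S v * x^-1 * V w * V u)) -> G x.
Proof.
elim: m s1 x => [|m IHm] s1 x s1_leaf s2_leaf Ux px pVx.
  apply: (G_polynomial s1_leaf s2_leaf) => // v w vs ws.
  by have := pVx v w [::] vs ws isT; rewrite wval_nil mulr1.
pose A := in_tuple s1; pose B := in_tuple s2.
have A_leaf : ordered_leaf_set A by [].
have B_leaf : ordered_leaf_set B by [].
pose P := \matrix_(i, j) eps (S (tnth A i) * x * V (tnth B j)).
pose g : L := umx A (invmx (col_ebase P)) A; pose h : L := umx B (invmx (row_ebase P)) B.
have [Ug Vg] : g \is a GRing.unit /\ g^-1 = umx A (col_ebase P) A.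
  by rewrite -[col_ebase P in RHS]invmxK; apply: umx_unit; rewrite // unitmx_inv col_ebase_unit.
have [Uh Vh] : h \is a GRing.unit /\ h^-1 = umx B (row_ebase P) B.
  by rewrite -[row_ebase P in RHS]invmxK; apply: umx_unit; rewrite // unitmx_inv row_ebase_unit.
have Gg : G g.
  by apply: G_umx => //; [apply: ordered_leaf_set_gt0|rewrite unitmx_inv col_ebase_unit].
have Gh : G h.
  by apply: G_umx => //; [apply: ordered_leaf_set_gt0|rewrite unitmx_inv row_ebase_unit].
pose y := g * x * h.
have -> : x = g^-1 * y * h^-1 by rewrite /y -!mulrA mulKr // mulrV // mulr1.
apply: (G_mul (G_mul (G_inv Gg) _) (G_inv Gh)).
have Uy : y \is a GRing.unit by rewrite !unitrMl.
have py : frame_pol s1 s2 y.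
  apply: (frame_polM s2_leaf); last exact: (frame_umx _ B_leaf).
  by apply: (frame_polM s1_leaf); first exact: (frame_umx _ A_leaf).
have pVy v w u : v \in s2 -> w \in s1 -> (m < size u)%N ->
    Pol (S v * y^-1 * V w * V u).
  move=> /(tnthP B)[i ->] /(tnthP A)[j ->] mu.
  rewrite /y !invrM ?unitrMl // Vg Vh mulrA umx_frameE // mulr_suml.
  apply: Pol_sum => k _ _; rewrite mulr_suml; apply: Pol_sum => l _ _.
  by rewrite -scalerAl; apply/PolZ/pVx; rewrite ?mem_tnth.
have eps_y i j : eps (S (tnth A i) * y * V (tnth B j)) = (pid_mx (\rank P) : 'M_(_, _)) i j.
  rewrite umx_frameE // eps_sum.
  have -> : pid_mx (\rank P) = invmx (col_ebase P) *m P *m invmx (row_ebase P).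
    rewrite -{3}(mulmx_ebase P) -!mulmxA mulmxV ?row_ebase_unit // mulmx1.
    by rewrite mulKmx ?col_ebase_unit.
  rewrite -mulmxA mxE; apply: eq_bigr => k _; rewrite eps_sum mxE mulr_sumr.
  by apply: eq_bigr => l _; rewrite epsZ mxE mulrCA mulrC.
clearbody y; pose r := \rank P.
have s1_split : ordered_leaf_set (take r s1 ++ drop r s1) by rewrite cat_take_drop.
apply: (IHm _ _ (ordered_leaf_set_expand_all d_gt0 s1_split)) => //.
  move=> v w; rewrite mem_cat => /orP[/mem_take|]; first exact: py.
  move=> /flattenP[s3 /mapP[c /(nthP [::])[k]]].
  rewrite size_drop ltn_subRL nth_drop => rk <- ->; rewrite mem_children.
  move=> /existsP[i /eqP->] /(tnthP B)[j ->].
  have -> : nth [::] s1 (r + k) = tnth A (Ordinal rk) by rewrite (tnth_nth [::]).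
  rewrite wstar_rcons -!mulrA astar_der !mulrA eps_y mxE /= ltnNge leq_addr andbF.
  by rewrite scale0r addr0; apply/Pol_der/py; rewrite mem_tnth.
move=> v w u vs; rewrite mem_cat => /orP[|] ws mu; last first.
  move: ws => /flattenP[_ /mapP[c /mem_drop cs ->]].
  rewrite mem_children => /existsP[i /eqP->].
  by rewrite wval_rcons mulrA -mulrA -wval_cons; apply: pVy.
case/(nthP [::]): ws => k; rewrite size_takel ?rank_leq_row // => kr.
rewrite nth_take // => <-{w}.
have k1 : (k < size s1)%N by rewrite (leq_trans kr) // rank_leq_row.
have k2 : (k < size s2)%N by rewrite (leq_trans kr) // rank_leq_col.
have -> : nth [::] s1 k = tnth A (Ordinal k1) by rewrite (tnth_nth [::]).
pose b := tnth B (Ordinal k2); pose t i := S (tnth A i) * y * V b.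
have tE i : S (tnth A i) * (y * V b) - \sum_l a l * der l (t i) =
    (i == Ordinal k1)%:R%:A.
  rewrite mulrA -/(t i) {1}[t i]eps_der addrK eps_y mxE /=.
  by rewrite -(inj_eq val_inj) /=; case: eqP => [->|_]; rewrite ?kr.
(* A retained leaf gains no letter from expansion. But column [k] of [y] has constant part 1 at row
   [k] and 0 elsewhere, so [V] of this leaf is [y * V b] up to terms containing a factor [a l]: the
   first cancels against [y^-1], and the others gain the letter that allows [m] in place of
   [m.+1]. *)
have -> : V (tnth A (Ordinal k1)) =
    y * V b - \sum_i V (tnth A i) * (\sum_l a l * der l (t i)).
  rewrite {1}[y * V b](leaf_expandl A_leaf) big_tuple -sumrB.
  rewrite (bigD1 (Ordinal k1)) //= [X in _ + X]big1 ?addr0 => [|i ik].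
    by rewrite -mulrBr tE eqxx scale1r mulr1.
  by rewrite -mulrBr tE (negPf ik) scale0r mulr0.
rewrite mulrBr mulrBl; apply: PolD.
  rewrite [S v * _ * _]mulrA mulrVK //; apply: PolM; last exact: Pol_wval.
  by apply: (Pol_leaf_ortho s2_leaf); rewrite ?mem_tnth.
apply: PolN; rewrite mulr_sumr mulr_suml; apply: Pol_sum => i _ _.
rewrite mulrA mulr_sumr mulr_suml; apply: Pol_sum => l _ _.
rewrite mulrA -wval1; apply: (@Pol_right_ideal m.+1) => //.
  by move=> w mw; apply: pVy; rewrite ?mem_tnth.
by apply/Pol_der/py; rewrite ?mem_tnth.
Qed.

Lemma eventually_Pol x : exists m, forall u, (m <= size u)%N -> Pol (x * V u).
Proof.
move: x; apply: leavitt_span => [|x y [m px] [n py]|c v w].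
- by exists 0%N => u _; rewrite mul0r; apply: Pol0.
- exists (maxn m n) => u; rewrite geq_max mulrDl => /andP[mu nu].
  by apply: PolD; [apply: px|apply: py].
exists (size w) => u wu; rewrite -scalerAl; apply: PolZ.
have [->|[v' [w' [-> w'0]]]] := wval_wstar_mul v w u; first exact: Pol0.
by rewrite w'0 // wstar_nil mulr1; apply: Pol_wval.
Qed.

Lemma G_unit x : x \is a GRing.unit -> G x.
Proof.
move=> Ux; have [m px] := eventually_Pol x.
have [s s_leaf sm] := ordered_leaf_set_long d_gt0 m.
have [n pVx] : exists n, forall v u, v \in s -> (n <= size u)%N -> Pol (S v * x^-1 * V u).
  elim: s {s_leaf sm} => [|v s [n IHs]]; first by exists 0%N.
  have [k pv] := eventually_Pol (S v * x^-1).
  exists (maxn k n) => w u; rewrite inE geq_max => /orP[/eqP->|ws] /andP[ku nu].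
    exact: pv.
  exact: IHs.
apply: (G_denominator (ordered_leaf_set_nil _) s_leaf Ux) => [v w|v w u vs].
  by rewrite inE => /eqP-> ws; rewrite wstar_nil mul1r; apply: px; rewrite sm.
rewrite inE => /eqP-> nu; rewrite wval_nil mulr1; apply: (pVx) => //; exact: nu.
Qed.

End LeavittFamily.

(** * The Leavitt algebra satisfies the abstract hypotheses *)

Section Leavitt.
Variables (K : fieldType) (d : nat) (d_ge2 : (2 <= d)%N).
Local Notation L := (leavitt K d_ge2).
Local Notation F := (free_algebra K d).
Local Notation a := (leavitt_a K d_ge2).
Local Notation a' := (leavitt_astar K d_ge2).

Lemma leavitt_astar_a i j : a' i * a j = (i == j)%:R.
Proof.
rewrite /leavitt_a /leavitt_astar -rmorphM -(rmorph_nat (leavitt_pi d_ge2)).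
by apply/leavitt_piP/leavitt_idealP/ideal_gen/leavitt_ortho.
Qed.

Lemma leavitt_sum_a_astar : \sum_i a i * a' i = 1.
Proof.
rewrite -(rmorph1 (leavitt_pi d_ge2)) /leavitt_a /leavitt_astar.
under eq_bigr do rewrite -rmorphM.
by rewrite -rmorph_sum; apply/leavitt_piP/leavitt_idealP/ideal_gen/leavitt_sum.
Qed.

Lemma malgU_mul (c1 c2 : K) (w1 w2 : {fmonom letter d}) :
  << c1 *g w1 >> * << c2 *g w2 >> = << c1 * c2 *g mmul w1 w2 >> :> F.
Proof. by rewrite malgM_def fgmulUU. Qed.

Lemma leavitt_alg_gen (P : L -> Prop) : P 0 -> P 1 ->
  (forall c x y, P x -> P y -> P (c *: x + y)) ->
  (forall x i, P x -> P (x * a i)) -> (forall x i, P x -> P (x * a' i)) ->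
  forall x, P x.
Proof.
move=> P0 P1 PD Pa Pa' x; rewrite -[x]leavitt_reprK [repr x]monalgE rmorph_sum.
apply: big_ind => // [y z Py Pz|w _]; first by rewrite -[y]scale1r; apply: PD.
have -> c : << c *g w >> = c *: << w >> + 0 :> F.
  by rewrite addr0 -mul_malgC malgU_mul mulr1 mul1m.
rewrite /= linearD linearZ rmorph0; apply: PD => //.
case: w => w; elim/last_ind: w => [|w l IHw].
  have -> : FMonom [::] = @mone {fmonom letter d} by apply: val_inj; rewrite /= fm1.
  by rewrite -[<< @mone {fmonom letter d} >>]/(1 : F) rmorph1.
have -> : FMonom (rcons w l) = mmul (FMonom w) (fmu l).
  by apply: val_inj; rewrite /= fmM /= fmU cats1.
rewrite -{1}[1](mulr1 (1 : K)) -malgU_mul rmorphM.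
by case: l => i; [apply: Pa|apply: Pa'].
Qed.

(** The chosen representative is immaterial because the defining ideal acts by zero. *)
Definition leavitt_act (x : L) (v : nat -> K) (m : nat) : K :=
  free_act (repr x) v m.

Lemma leavitt_act_pi (f : F) v m :
  leavitt_act (leavitt_pi d_ge2 f) v m = free_act f v m.
Proof.
apply/eqP; rewrite -subr_eq0 -free_actB free_act_ideal ?(ltnW d_ge2) //.
by apply/leavitt_piP; rewrite leavitt_reprK.
Qed.

Lemma leavitt_act_lin c x y v m : leavitt_act (c *: x + y) v m =
  c * leavitt_act x v m + leavitt_act y v m.
Proof.
rewrite -[x]leavitt_reprK -[y]leavitt_reprK -linearP !leavitt_act_pi.
rewrite {1}/free_act mmapD -mul_malgC -/(free_act _ v m) free_actM.
by rewrite {1}/free_act mmapU fm1.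
Qed.

Lemma leavitt_act1 v m : leavitt_act 1 v m = v m.
Proof. by rewrite -(rmorph1 (leavitt_pi d_ge2)) leavitt_act_pi free_act1. Qed.

Lemma leavitt_actM x y v m :
  leavitt_act (x * y) v m = leavitt_act x (leavitt_act y v) m.
Proof.
rewrite -[x in LHS]leavitt_reprK -[y in LHS]leavitt_reprK -rmorphM leavitt_act_pi.
exact: free_actM.
Qed.

Lemma leavitt_act_a i v m :
  leavitt_act (a i) v m = if (m %% d == i)%N then v (m %/ d)%N else 0.
Proof. by rewrite leavitt_act_pi free_actU fmU. Qed.

Lemma leavitt_act_astar i v m : leavitt_act (a' i) v m = v (m * d + i)%N.
Proof. by rewrite leavitt_act_pi free_actU fmU. Qed.

End Leavitt.

Theorem theorem7p2 (K : fieldType) (d : nat) (d_ge2 : (2 <= d)%N)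
    (x : leavitt K d_ge2) :
  LGL x <-> x \is a GRing.unit.
Proof.
have ortho := @leavitt_astar_a K d d_ge2.
have sum1 := @leavitt_sum_a_astar K d d_ge2.
split=> [|Ux].
  elim=> {x} [_ [n A B M _ A_leaf B_leaf M_unit]||x y _ Ux _ Uy|x _ Ux].
  - by have [U _] := umx_unit ortho sum1 A_leaf B_leaf M_unit.
  - exact: unitr1.
  - rewrite (unitrMl x Uy); exact: Ux.
  - by rewrite unitrV.
apply: (G_unit d_ge2 ortho sum1 (@leavitt_alg_gen K d d_ge2) _ _ _ _
  (@leavitt_act_lin K d d_ge2) (@leavitt_act1 K d d_ge2)
  (@leavitt_actM K d d_ge2) (@leavitt_act_a K d d_ge2)
  (@leavitt_act_astar K d d_ge2) Ux).
- by move=> n A B M n0 A_leaf B_leaf M_unit; apply/subgroup_gen/LGL_gen_u.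
- exact: subgroup_one.
- by move=> y z Gy Gz; apply: subgroup_mul.
- by move=> y Gy; apply: subgroup_inv.
Qed.
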